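(* There is a pseudo-polynomial time $4\kappa$-approximation algorithm for scheduling jobs with release dates on a single machine with general (nondecreasing) cost functions, i.e. for the problem described in the context, where $\kappa$ is the number of distinct release dates.
   Context: Problem: a set of $n$ jobs, each job $j$ with a positive integer processing time $p_j$, a nonnegative integer release date $r_j$, and a nondecreasing cost function $f_j$ with nonnegative values; $\kappa$ denotes the number of distinct values among $r_1,\dots,r_n$. Jobs are processed on a single machine that processes at most one job at a time; preemption is allowed, and job $j$ may be processed only at times after $r_j$. With $C_j$ the completion time of job $j$, the objective is to minimize $\sum_jf_j(C_j)$. A pseudo-polynomial time $4\kappa$-approximation algorithm is an algorithm running in time polynomial in $n$ and the time horizon $\max_jr_j+\sum_jp_j$ that always outputs a feasible schedule of cost at most $4\kappa$ times the optimal cost. *)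

(* Defs.v *)
From HB Require Import structures.
From mathcomp Require Import all_boot all_order all_algebra.
From mathcomp Require Import classical_sets reals.
Set Implicit Arguments.
Unset Strict Implicit.
Unset Printing Implicit Defensive.
Import Order.TTheory GRing.Theory Num.Theory.
Local Open Scope ring_scope.

(** * Scheduling with release dates on a single machine *)

Record instance (R : realType) := Instance {
  njobs : nat;
  ptime : 'I_njobs -> nat;
  rdate : 'I_njobs -> nat;
  jcost : 'I_njobs -> R -> R;
  ptime_gt0 : forall j, (0 < ptime j)%N;
  jcost_ge0 : forall j x, 0 <= x -> 0 <= jcost j x;
  jcost_nondecreasing :
    forall j x y, 0 <= x -> x <= y -> jcost j x <= jcost j y }.

Arguments ptime {R} i j.
Arguments rdate {R} i j.
Arguments jcost {R} i j x.

Definition horizon (R : realType) (I : instance R) : nat :=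
  (\max_(j < njobs I) rdate I j + \sum_(j < njobs I) ptime I j)%N.

Definition nrelease (R : realType) (I : instance R) : nat :=
  size (undup (codom (rdate I))).

(** The time axis is continuous.  A preemptive schedule is a finite list, in no
    particular order, of pieces (j, a, b): the machine works on job j during
    the time interval from a to b. *)
Definition piece (R : realType) (n : nat) : Type := ('I_n * R * R)%type.
Definition pjob (R : realType) (n : nat) (x : piece R n) : 'I_n := x.1.1.
Definition pstart (R : realType) (n : nat) (x : piece R n) : R := x.1.2.
Definition pstop (R : realType) (n : nat) (x : piece R n) : R := x.2.

Definition schedule (R : realType) (I : instance R) : Type :=
  seq (piece R (njobs I)).

Definition feasible (R : realType) (I : instance R) (S : schedule I) : Prop :=
  [/\ forall x, x \in S ->
        (rdate I (pjob x))%:R <= pstart x /\ pstart x < pstop x,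
      pairwise
        (fun x y => (pstop x <= pstart y) || (pstop y <= pstart x)) S
    & forall j, \sum_(x <- S | pjob x == j) (pstop x - pstart x)
                = (ptime I j)%:R].

Definition completion (R : realType) (I : instance R) (S : schedule I)
    (j : 'I_(njobs I)) : R :=
  \big[Num.max/0]_(x <- S | pjob x == j) pstop x.

Definition total_cost (R : realType) (I : instance R) (S : schedule I) : R :=
  \sum_(j < njobs I) jcost I j (completion S j).

Definition opt_cost (R : realType) (I : instance R) : R :=
  inf [set total_cost S | S in [set S : schedule I | feasible S]]%classic.

(** * Model of computation

    A random access machine, programmed by while programs.  The memory
    consists of arrays of naturals and arrays of reals, all of unbounded length;
    the arrays used by a program are named by literals.

    Each assignment and each test costs one time unit.  Since expressions
    have a fixed size given by the program, this amounts, up to a constant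
    factor, to charging one unit per elementary operation.  The elementary
    operations are chosen so that this measure is realistic:
    - naturals only have addition and truncated subtraction, so t steps
      lengthen their binary representation by O(t) bits only (unit-cost
      multiplication would allow repeated squaring);
    - reals, which hold values of the cost functions, only have addition,
      subtraction, comparison, and multiplication and division by a natural;
      there is no product of two reals and no rounding of a real to a natural.
      On rational costs, numerators and denominators keep polynomial length.

    The cost functions are accessed through a value oracle: [RCost j t] is the
    cost of job j at the integer time t. *)

Inductive nexp : Type :=
| NConst of nat
| NGet of nat & nexp
| NAdd of nexp & nexp
| NSub of nexp & nexp.

Inductive rexp : Type :=
| RGet of nat & nexp
| RCost of nexp & nexp
| RAdd of rexp & rexp
| RSub of rexp & rexp
| RMuln of rexp & nexp
| RDivn of rexp & nexp.

Inductive bexp : Type :=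
| BNLe of nexp & nexp
| BRLe of rexp & rexp
| BNot of bexp
| BAnd of bexp & bexp.

Inductive cmd : Type :=
| Skip
| NSet of nat & nexp & nexp
| RSet of nat & nexp & rexp
| Seq of cmd & cmd
| If of bexp & cmd & cmd
| While of bexp & cmd.

Record memory (R : realType) := Memory {
  nmem : nat -> nat -> nat;
  rmem : nat -> nat -> R }.

Definition update (T : Type) (m : nat -> nat -> T) (a i : nat) (v : T) :
    nat -> nat -> T :=
  fun b k => if (b == a) && (k == i) then v else m b k.

Fixpoint neval (R : realType) (m : memory R) (e : nexp) : nat :=
  match e with
  | NConst k => k
  | NGet a i => nmem m a (neval m i)
  | NAdd e1 e2 => (neval m e1 + neval m e2)%N
  | NSub e1 e2 => (neval m e1 - neval m e2)%N
  end.

Fixpoint reval (R : realType) (oracle : nat -> nat -> R) (m : memory R)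
    (e : rexp) : R :=
  match e with
  | RGet a i => rmem m a (neval m i)
  | RCost j t => oracle (neval m j) (neval m t)
  | RAdd e1 e2 => reval oracle m e1 + reval oracle m e2
  | RSub e1 e2 => reval oracle m e1 - reval oracle m e2
  | RMuln e1 k => reval oracle m e1 * (neval m k)%:R
  | RDivn e1 k => reval oracle m e1 / (neval m k)%:R
  end.

Fixpoint beval (R : realType) (oracle : nat -> nat -> R) (m : memory R)
    (b : bexp) : bool :=
  match b with
  | BNLe e1 e2 => (neval m e1 <= neval m e2)%N
  | BRLe e1 e2 => reval oracle m e1 <= reval oracle m e2
  | BNot b1 => ~~ beval oracle m b1
  | BAnd b1 b2 => beval oracle m b1 && beval oracle m b2
  end.

(** [exec oracle c m t m']: started in memory m, the program c halts after
    t time units in memory m'. *)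
Inductive exec (R : realType) (oracle : nat -> nat -> R) :
    cmd -> memory R -> nat -> memory R -> Prop :=
| exec_skip m : exec oracle Skip m 1%N m
| exec_nset a i e m :
    exec oracle (NSet a i e) m 1%N
      (Memory (update (nmem m) a (neval m i) (neval m e)) (rmem m))
| exec_rset a i e m :
    exec oracle (RSet a i e) m 1%N
      (Memory (nmem m) (update (rmem m) a (neval m i) (reval oracle m e)))
| exec_seq c1 c2 m1 m2 m3 t1 t2 :
    exec oracle c1 m1 t1 m2 -> exec oracle c2 m2 t2 m3 ->
    exec oracle (Seq c1 c2) m1 (t1 + t2)%N m3
| exec_if b c1 c2 m t m' :
    exec oracle (if beval oracle m b then c1 else c2) m t m' ->
    exec oracle (If b c1 c2) m t.+1 m'
| exec_while_false b c m :
    ~~ beval oracle m b -> exec oracle (While b c) m 1%N m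
| exec_while_true b c m1 m2 m3 t1 t2 :
    beval oracle m1 b ->
    exec oracle c m1 t1 m2 -> exec oracle (While b c) m2 t2 m3 ->
    exec oracle (While b c) m1 (t1 + t2)%N.+1 m3.

Lemma exec_det (R : realType) (oracle : nat -> nat -> R) (c : cmd)
    (m : memory R) (t : nat) (m' : memory R) :
  exec oracle c m t m' ->
  forall t2 m2, exec oracle c m t2 m2 -> t = t2 /\ m' = m2.
Proof.
elim=> {c m t m'}.
- by move=> m t2 m2 E; inversion E.
- by move=> a i e m t2 m2 E; inversion E.
- by move=> a i e m t2 m2 E; inversion E.
- move=> c1 c2 m1 m2 m3 t1 t2 _ IH1 _ IH2 t m E.
  inversion E as [| | |? ? ? k ? ? ? E1 E2| | |]; subst.
  by have [-> ?] := IH1 _ _ E1; subst k; have [-> ->] := IH2 _ _ E2.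
- move=> b c1 c2 m t m' _ IH t2 m2 E.
  inversion E as [| | | |? ? ? ? ? ? E1| |]; subst.
  by have [-> ->] := IH _ _ E1.
- move=> b c m bF t2 m2 E.
  inversion E as [| | | | | |? ? ? ? ? ? ? bT]; subst => //.
  by rewrite bT in bF.
- move=> b c m1 m2 m3 t1 t2 bT _ IH1 _ IH2 t m E.
  inversion E as [| | | | |? ? ? bF|? ? ? k ? ? ? _ E1 E2]; subst.
    by rewrite bT in bF.
  by have [-> ?] := IH1 _ _ E1; subst k; have [-> ->] := IH2 _ _ E2.
Qed.

(** Input: array 0 holds the number of jobs (in cell 0), array 1 the
    processing times and array 2 the release dates; the rest is zero. *)
Definition input_nmem (R : realType) (I : instance R) (a i : nat) : nat :=
  match a with
  | 0 => if i == 0%N then njobs I else 0%N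
  | 1 => if insub i is Some j then ptime I j else 0%N
  | 2 => if insub i is Some j then rdate I j else 0%N
  | _ => 0%N
  end.

Definition input (R : realType) (I : instance R) : memory R :=
  Memory (input_nmem I) (fun _ _ => 0).

Definition cost_oracle (R : realType) (I : instance R) (i t : nat) : R :=
  if insub i is Some j then jcost I j t%:R else 0.

Definition halts_on (R : realType) (A : cmd) (I : instance R) (t : nat)
    (m : memory R) : Prop :=
  exec (cost_oracle I) A (input I) t m.

(** Output: array 3 holds the number of pieces (in cell 0), and arrays 4, 5
    and 6 their jobs, start times and stop times. *)
Definition output (R : realType) (I : instance R) (m : memory R)
    (S : schedule I) : Prop :=
  [seq (val (pjob x), pstart x, pstop x) | x <- S] =
  [seq (nmem m 4 i, (nmem m 5 i)%:R, (nmem m 6 i)%:R)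
     | i <- iota 0 (nmem m 3 0)].

(** Polynomial time in the number of jobs and the horizon. *)
Definition pseudo_polynomial_time (R : realType) (A : cmd) : Prop :=
  exists a d : nat, forall I : instance R,
    exists t m, halts_on A I t m /\ (t <= a * (njobs I + horizon I).+1 ^ d)%N.

(** Halting time and final memory are unique by [exec_det]. *)
Definition approximation_algorithm (R : realType) (A : cmd)
    (rho : instance R -> R) : Prop :=
  forall I : instance R, exists t m (S : schedule I),
    [/\ halts_on A I t m, output m S, feasible S
      & total_cost S <= rho I * opt_cost I].

(* Main.v *)
(** Only due dates matter: [d] can be met by a preemptive schedule iff for every
    release date [r k] and every [t] the jobs released from [r k] on with due
    date at most [t] have total processing time at most [t - r k]; the earliest
    due date rule then produces the schedule.  The amount by which this fails is
    the excess of [d] at [(k, t)].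

    The algorithm is a local-ratio one.  It starts from all due dates 0 and
    takes the pair [(k, t)] of largest excess [D].  Each job [j] released from
    [r k] on and due by [t] is charged [min (p j) D] for being moved past [t];
    the largest multiple of this cost that keeps all residual costs nonnegative
    is subtracted, and a job is moved to a due date whose residual cost became 0.
    Once the excess vanishes, the moves are undone in reverse order whenever
    this creates no excess.

    Any solution pays at least [D] for the cost subtracted in a step.  In the
    solution of the algorithm every job moved past [t] is indispensable at some
    pair [(k', t')]; group these jobs by [r k'] and by whether [t <= t'].  In
    each group, the job with extremal [t'] is indispensable at a pair which all
    jobs of the group cover, so the others weigh at most the excess at that
    pair, that is at most [D].  The [2 kappa] groups thus pay at most [2 D] each. *)

Require Import Defs.
From mathcomp Require Import all_boot all_order all_algebra.
From mathcomp Require Import classical_sets reals boolp.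
From mathcomp Require Import zify lra.
Set Implicit Arguments.
Unset Strict Implicit.
Unset Printing Implicit Defensive.
Import Order.TTheory GRing.Theory Num.Theory.
Local Open Scope nat_scope.

(** * Due dates and excess *)

Definition set_at (f : nat -> nat) (j v : nat) : nat -> nat :=
  fun i => if i == j then v else f i.

Section DueDates.
Variables (n : nat) (p r : nat -> nat).
Implicit Types (d e s : nat -> nat) (k t : nat).

Definition load d k t := \sum_(j < n | (r k <= r j) && (d j <= t)) p j.

Definition excess d k t := load d k t - (t - r k).

Definition covers d := forall k t, k < n -> excess d k t = 0.

Lemma leq_load d e k t :
  (forall j, j < n -> d j <= e j) -> load e k t <= load d k t.
Proof.
move=> de; rewrite /load [leqLHS]big_mkcond [leqRHS]big_mkcond.
apply: leq_sum => j _; case: (r k <= r j) => //=.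
by case: ifP => // et; rewrite (leq_trans (de j _) et).
Qed.

(** From such an [h] on, the allowance [t - r k] is at least the total processing time, so only
    finitely many times need inspection. *)
Lemma excess_horizon d k t h :
  r k + \sum_(j < n) p j <= h -> h <= t -> excess d k t = 0.
Proof.
move=> le_h le_t; apply/eqP; rewrite subn_eq0.
have : load d k t <= \sum_(j < n) p j.
  by rewrite /load big_mkcond; apply: leq_sum => j _; case: ifP.
by lia.
Qed.

(** At [t = r j] the allowance is zero, so a job due by its own release date would create excess by
    itself. *)
Lemma covers_gt_release d j :
  (forall i, i < n -> 0 < p i) -> covers d -> j < n -> r j < d j.
Proof.
move=> p_gt0 cov jn; rewrite ltnNge; apply/negP => dj.
have := cov j (r j) jn; rewrite /excess /load subnn subn0.
rewrite (bigD1 (Ordinal jn)) /= ?leqnn ?dj //.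
by have := p_gt0 j jn; lia.
Qed.

(** [covers] only speaks of intervals that start at a release date. From any other left end [a], the
    interval shrinks to the earliest release date among the counted jobs without losing a job. *)
Lemma covers_load d a t :
  (forall i, i < n -> 0 < p i) -> covers d -> a <= t ->
  \sum_(j < n | (a <= r j) && (d j <= t)) p j <= t - a.
Proof.
move=> p_gt0 cov a_t.
have [k0 | none] := pickP (fun k : 'I_n => (a <= r k) && (d k <= t)); last first.
  by rewrite big_pred0.
move=> k0P; case: (@arg_minnP _ k0 (fun k : 'I_n => (a <= r k) && (d k <= t))
  (fun k : 'I_n => r k) k0P) => k /andP[ak dk] kmin.
have : excess d k t = 0 by apply: cov.
have rk := covers_gt_release p_gt0 cov (ltn_ord k).
have : \sum_(j < n | (a <= r j) && (d j <= t)) p j <= load d k t.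
  rewrite /load [leqLHS]big_mkcond [leqRHS]big_mkcond.
  by apply: leq_sum => j _; case: ifP => // jP; rewrite kmin // (andP jP).2.
by rewrite /excess; lia.
Qed.

(** Truncation at the deficit, as in knapsack cover inequalities: it preserves the lower bound of
    [weight_cover] and makes the upper bound of [weight_group] possible. *)
Definition weight D j := minn (p j) D.

(** Either one moved job is so long that its truncated weight already equals the excess, or no
    weight is truncated and the drop in load from [s] to [e] must absorb the excess. *)
Lemma weight_cover s e k t : covers e -> k < n ->
  excess s k t <=
    \sum_(j < n | [&& r k <= r j, s j <= t & t < e j]) weight (excess s k t) j.
Proof.
move=> cov kn; set D := excess s k t.
case: (pickP (fun j : 'I_n => [&& r k <= r j, s j <= t & t < e j] && (D <= p j))).
  move=> j /andP[jP Dj]; rewrite (bigD1 j) //=.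
  by rewrite {1}/weight (minn_idPr Dj) leq_addr.
move=> small; rewrite (eq_bigr (fun j : 'I_n => p j)); last first.
  by move=> j jP; have := small j; rewrite jP /= /weight => /negbT; lia.
have : load s k t <=
    load e k t + \sum_(j < n | [&& r k <= r j, s j <= t & t < e j]) p j.
  rewrite /load [leqLHS]big_mkcond [X in _ <= X + _]big_mkcond.
  rewrite [X in _ <= _ + X]big_mkcond -big_split /=; apply: leq_sum => j _.
  case: (r k <= r j) => //=; case: (s j <= t) => //=.
  by rewrite [t < _]ltnNge; case: (e j <= t) => //=; rewrite leq_addr.
  have := cov k t kn; rewrite /D /excess; set x := \sum_(_ < _ | _) _; lia.
Qed.

(* All jobs of the group [G] cover time [t] in [d] but not in [s], and one of
   them, [j0], is indispensable there. *)
Lemma weight_group s d k t D (G : pred 'I_n) (j0 : 'I_n) :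
  (forall j, j < n -> s j <= d j) -> k < n ->
  excess s k t <= D -> 0 < excess (set_at d j0 (s j0)) k t -> G j0 ->
  (forall j, G j -> [&& r k <= r j, s j <= t & t < d j]) ->
  \sum_(j < n | G j) weight D j <= 2 * D.
Proof.
move=> sd kn sD ness Gj0 GP.
have /and3P[rj0 sj0 dj0] := GP _ Gj0.
have load0 : load (set_at d j0 (s j0)) k t = load d k t + p j0.
  rewrite /load /set_at (bigD1 j0) /= ?eqxx ?rj0 ?sj0 // addnC; congr (_ + _).
  apply: eq_big => [j|//]; rewrite -val_eqE /=.
  case: eqVneq => [->|]; last by rewrite andbT.
  by rewrite andbF [d j0 <= t]leqNgt dj0 andbF.
(* The jobs counted in the load of [d] and those of [G] are disjoint, and [s] counts both kinds. *)
have load1 : load d k t + \sum_(j < n | G j) p j <= load s k t.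
  rewrite /load [leqRHS]big_mkcond [X in X + _ <= _]big_mkcond.
  rewrite [X in _ + X <= _]big_mkcond -big_split /=; apply: leq_sum => j _.
  case: ifP => [/andP[-> dj]|_] /=.
    rewrite (leq_trans (sd _ _) dj) //; case: ifP => [/GP /and3P[_ _]|_].
      by rewrite ltnNge dj.
    by rewrite addn0.
  by case: ifP => // /GP /and3P[-> -> _].
(* The load bounds leave less than [D] of processing time to the jobs of [G] other than [j0], and
   [j0] itself weighs at most [D]. *)
have : \sum_(j < n | G j && (j != j0)) weight D j
    <= \sum_(j < n | G j && (j != j0)) p j.
  by apply: leq_sum => j _; apply: geq_minl.
move: load1; rewrite (bigD1 j0) //= [X in _ -> _ -> X <= _](bigD1 j0) //=.
have : weight D j0 <= D by apply: geq_minr.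
set x := \sum_(_ < _ | _) p _; set y := \sum_(_ < _ | _) _.
by move: ness sD; rewrite /excess load0; lia.
Qed.

Definition nreleases := size (undup [seq r j | j <- iota 0 n]).

Lemma weight_minimal s d k t :
  (forall j, j < n -> s j <= d j) -> covers d ->
  (forall j, j < n -> s j < d j -> ~ covers (set_at d j (s j))) ->
  (forall k' t', k' < n -> excess s k' t' <= excess s k t) ->
  \sum_(j < n | [&& r k <= r j, s j <= t & t < d j]) weight (excess s k t) j
    <= 4 * nreleases * excess s k t.
Proof.
move=> sd cov minimal maxD; set D := excess s k t.
pose C (j : 'I_n) := [&& r k <= r j, s j <= t & t < d j].
(* [w j] is a pair at which putting [j] back creates excess; jobs outside [C] get a dummy value. *)
have /choice[w wP] (j : 'I_n) : exists kt : nat * nat, C j ->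
    [/\ kt.1 < n, 0 < excess (set_at d j (s j)) kt.1 kt.2
      & [&& r kt.1 <= r j, s j <= kt.2 & kt.2 < d j]].
  have [Cj|] := boolP (C j); last by exists (0, 0).
  have /and3P[_ sj dj] := Cj.
  have := minimal j (ltn_ord j) (leq_ltn_trans sj dj).
  move=> /existsNP[k' /existsNP[t' /not_implyP[k'n /eqP]]].
  rewrite -lt0n => pos; exists (k', t') => _; split=> //=.
  (* Only the due date of [j] has changed, so excess can arise only where [j] is newly counted. *)
  have := cov k' t' k'n; move: pos; rewrite /excess /load => pos zero.
  apply/negP => /negP bad; move: pos zero.
  have -> : \sum_(j0 < n | (r k' <= r j0) && (set_at d j (s j) j0 <= t')) p j0
     = \sum_(j0 < n | (r k' <= r j0) && (d j0 <= t')) p j0; last by lia.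
  apply: eq_bigl => i; rewrite /set_at; case: eqVneq => // ->.
  case: (leqP (r k') (r j)) bad => //= _.
  have := sd j (ltn_ord j).
  by case: (leqP (s j) t'); case: (leqP (d j) t') => //; lia.
pose U := undup [seq r j | j <- iota 0 n].
pose Z (x : nat * bool) (j : 'I_n) :=
  [&& C j, r (w j).1 == x.1 & (t <= (w j).2) == x.2].
have group x : \sum_(j < n | Z x j) weight D j <= 2 * D.
  have [j1 Zj1|none] := pickP (Z x); last by rewrite big_pred0.
  (* Every job of the group covers both [t] and its own witness time, hence all times between. From
     [t] on the earliest witness time is thus covered by all of them; before [t], the latest. *)
  have [j0 Zj0 ext] : exists2 j0, Z x j0 & forall j, Z x j ->
      if x.2 then (w j0).2 <= (w j).2 else (w j).2 <= (w j0).2.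
    case: x.2.
      case: (@arg_minnP _ j1 (Z x) (fun j : 'I_n => (w j).2) Zj1) => j0 ? ?.
      by exists j0.
    case: (@arg_maxnP _ j1 (Z x) (fun j : 'I_n => (w j).2) Zj1) => j0 ? ?.
    by exists j0.
  have /and3P[Cj0 /eqP r0 /eqP t0] := Zj0.
  have [k0n ness _] := wP _ Cj0.
  apply: (weight_group sd k0n (maxD _ _ k0n) ness Zj0) => j Zj.
  have /and3P[Cj /eqP rj /eqP tj] := Zj; have [_ _] := wP _ Cj.
  rewrite r0 -rj => /and3P[-> sj dj] /=.
  have := ext j Zj; have /and3P[_ sjt djt] := Cj.
  by rewrite -t0; move: tj; rewrite -t0; case: (leqP t (w j0).2); lia.
(* All group labels: the values of the release dates times the two sides of [t]. With [2 * D] per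
   group this yields the factor 4. *)
pose L := [seq (u, b) | u <- U, b <- [:: true; false]].
have uniqL : uniq L.
  by apply: allpairs_uniq => [||[? ?] [? ?] _ _ [-> ->]] //; apply: undup_uniq.
have sizeL : size L = nreleases * 2 by rewrite size_allpairs.
have memL x : x.1 \in U -> x \in L.
  by case: x => u b Uu; apply/allpairsPdep; exists u, b; split=> //; case: (b).
have -> : \sum_(j < n | C j) weight D j =
    \sum_(x <- L) \sum_(j < n | Z x j) weight D j.
  rewrite (exchange_big_dep C) /=; last by move=> x j _ /and3P[].
  apply: eq_bigr => j Cj; have [kn _ _] := wP _ Cj.
  (* Each job lies in exactly one group, the one labelled by its own witness. *)
  rewrite big_mkcond (bigD1_seq (r (w j).1, t <= (w j).2)) //=; last first.
    by apply: memL; rewrite mem_undup; apply: map_f; rewrite mem_iota.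
  rewrite /Z Cj !eqxx /= big1 ?addn0 // => -[u b].
  rewrite xpair_eqE [u == _]eq_sym [b == _]eq_sym /=.
  by case: (_ == u) => //=; case: (_ == b).
apply: (@leq_trans (\sum_(x <- L) 2 * D)).
  by apply: leq_sum => x _; apply: group.
by rewrite big_const_seq count_predT iter_addn_0 sizeL; lia.
Qed.

End DueDates.

(** * The local-ratio step *)

Section LocalRatio.
Variables (R : realType) (n h : nat) (p r : nat -> nat).
Implicit Types (s d e : nat -> nat) (g : nat -> nat -> R).

(** Invariant of the pushes: the current due dates are free in the residual cost, hence optimal for
    it as soon as they cover. *)
Definition residual_ok s g : Prop :=
  (forall j, j < n -> s j <= h /\ g j (s j) = 0%R) /\
  (forall j t, j < n -> t <= h -> (0 <= g j t)%R).

Definition affected s k t j u := [&& r k <= r j, s j <= t & t < u].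

Definition reduce s k t (alpha : R) g j u : R :=
  if affected s k t j u
  then (g j u - alpha * (weight p (excess n p r s k t) j)%:R)%R else g j u.

(** The conditions on [g'] are pointwise, for jobs below [n] and dates up to [h]: this is the part
    of the residual table that the program stores. *)
Variant push s g j s' g' : Prop :=
  Push k t u alpha of k < n & 0 < excess n p r s k t
    & (forall k' t', k' < n -> excess n p r s k' t' <= excess n p r s k t)
    & (0 <= alpha)%R & j < n & affected s k t j u & u <= h
    & s' = set_at s j u
    & (forall i v, i < n -> v <= h -> g' i v = reduce s k t alpha g i v)
    & (forall i v, i < n -> v <= h -> (0 <= g' i v)%R) & g' j u = 0%R.

(** The log has the latest push first and records the due date that each pushed job had before. *)
Inductive pushes s0 g0 : seq (nat * nat) -> (nat -> nat) ->
    (nat -> nat -> R) -> Prop :=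
| Pushes0 : pushes s0 g0 [::] s0 g0
| PushesS log s g j s' g' : pushes s0 g0 log s g -> push s g j s' g' ->
    pushes s0 g0 ((j, s j) :: log) s' g'.

Lemma push_ok s g j s' g' :
  residual_ok s g -> push s g j s' g' -> residual_ok s' g'.
Proof.
move=> [sh g_ge0] [k t u alpha kn Dpos maxD a0 jn ju uh -> g'E g'0 g'ju].
split=> // i i_n; rewrite /set_at; case: eqVneq => [->|ij]; first by [].
have [si gi] := sh i i_n; split=> //.
(* The entry at [s i] is unchanged: being affected would require [s i <= t < s i]. *)
by rewrite g'E // /reduce /affected gi; case: ifP => //; lia.
Qed.

Lemma pushes_ok s0 g0 log s g :
  residual_ok s0 g0 -> pushes s0 g0 log s g -> residual_ok s g.
Proof.
by move=> ok0; elim=> // l s1 g1 j s' g' _ IH /(push_ok IH).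
Qed.

Lemma pushes_nil s0 g0 s g : pushes s0 g0 [::] s g -> s = s0 /\ g = g0.
Proof. by move=> ps; inversion ps. Qed.

Lemma pushes_cons s0 g0 j v log s' g' : pushes s0 g0 ((j, v) :: log) s' g' ->
  exists s g, [/\ pushes s0 g0 log s g, push s g j s' g' & v = s j].
Proof. by move=> ps; inversion ps; subst; exists s, g. Qed.

(** A pushed job moves from a date at most [t] to one beyond [t]. This potential bounds the number
    of pushes. *)
Lemma push_grows s g j s' g' : push s g j s' g' ->
  \sum_(i < n) s i < \sum_(i < n) s' i.
Proof.
move=> [k t u alpha _ _ _ _ jn ju _ -> _ _ _].
rewrite (bigD1 (Ordinal jn)) // [ltnRHS](bigD1 (Ordinal jn)) //=.
rewrite [X in _ < X + _]/set_at eqxx.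
have -> : \sum_(i < n | i != Ordinal jn) set_at s j u i =
          \sum_(i < n | i != Ordinal jn) s i.
  by apply: eq_bigr => i; rewrite /set_at -val_eqE /= => /negbTE ->.
by case/and3P: ju => _ sj ju; rewrite ltn_add2r (leq_ltn_trans sj ju).
Qed.

Definition residual_cost g d : R := (\sum_(j < n) g j (d j))%R.

(** The guarantee is bundled with minimality over [s], which [weight_minimal] requires, so that both
    can be carried back along the log. *)
Definition near_optimal s g d : Prop :=
  [/\ forall j, j < n -> s j <= d j <= h,
      covers n p r d,
      forall j, j < n -> s j < d j -> ~ covers n p r (set_at d j (s j))
    & forall e, (forall j, j < n -> e j <= h) -> covers n p r e ->
        (residual_cost g d <= (4 * nreleases n r)%:R * residual_cost g e)%R].

Lemma near_optimal_ok s g :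
  residual_ok s g -> covers n p r s -> near_optimal s g s.
Proof.
move=> [sh g_ge0] cov; split=> // [j jn|j _|e eh _].
- by rewrite leqnn; have [] := sh j jn.
- by rewrite ltnn.
rewrite {1}/residual_cost big1 => [|j _]; last by have [] := sh j (ltn_ord j).
by rewrite mulr_ge0 // sumr_ge0 // => j _; apply: g_ge0; rewrite ?eh.
Qed.

(** The local-ratio decomposition: [reduce] takes [alpha] times the weight off exactly the affected
    entries. *)
Lemma residual_cost_reduce s k t alpha g g' d :
  (forall j, j < n -> d j <= h) ->
  (forall i v, i < n -> v <= h -> g' i v = reduce s k t alpha g i v) ->
  residual_cost g d = (residual_cost g' d + alpha *
    (\sum_(j < n | affected s k t j (d j))
       weight p (excess n p r s k t) j)%:R)%R.
Proof.
move=> dh g'E; rewrite /residual_cost [X in (_ * X%:R)%R]big_mkcond natr_sum mulr_sumr.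
rewrite -big_split /=.
apply: eq_bigr => j _; rewrite g'E ?dh // /reduce.
by case: ifP => _; rewrite ?subrK // mulr0 addr0.
Qed.

(** The induction step of the local-ratio argument: the factor holds for the residual cost and for
    the subtracted cost, hence for their sum. *)
Lemma near_optimal_undo s g j s' g' d d' :
  residual_ok s g -> push s g j s' g' -> near_optimal s' g' d ->
  d' = set_at d j (s j) /\ covers n p r d' \/
  d' = d /\ ~ covers n p r (set_at d j (s j)) ->
  near_optimal s g d'.
Proof.
move=> [sh g_ge0] [k t u alpha kn Dpos maxD a0 jn ju uh -> g'E g'0 g'ju].
move=> [sd cov minimal opt] d'P.
have sd0 i : i < n -> s i <= d i <= h.
  move=> i_n; have := sd i i_n; rewrite /set_at.
  by case: eqVneq => [->|//]; move: ju; rewrite /affected; lia.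
have sd' i : i < n -> s i <= d' i <= h.
  move=> i_n; have := sd0 i i_n; case: d'P => -[-> _] //.
  by rewrite /set_at; case: eqVneq => [->|//]; have [] := sh j jn; lia.
have d'd i : i < n -> d' i <= d i.
  move=> i_n; case: d'P => -[-> _] //; rewrite /set_at.
  by case: eqVneq => [->|//]; have /andP[] := sd0 j jn.
have cov' : covers n p r d' by case: d'P => -[->].
have min' i : i < n -> s i < d' i -> ~ covers n p r (set_at d' i (s i)).
  move=> i_n si; have [ij|ij] := eqVneq i j.
    case: d'P => -[d'E ncov]; last by rewrite ij d'E.
    by move: si; rewrite d'E /set_at ij eqxx ltnn.
  have set_i : set_at s j u i = s i by rewrite /set_at (negbTE ij).
  have := minimal i i_n; rewrite set_i.
  move=> /(_ (leq_trans si (d'd i i_n))) min_i.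
  (* As [d'] is pointwise at most [d], it has at least the load of [d]; if [d'] still covers after
     putting [i] back, so does [d]. *)
  move=> cov1; apply: min_i => k' t' k'n; have := cov1 k' t' k'n.
  rewrite /excess.
  have : load n p r (set_at d i (s i)) k' t' <=
         load n p r (set_at d' i (s i)) k' t'; last by lia.
  by apply: leq_load => l ln; rewrite /set_at; case: eqVneq => // _; apply: d'd.
split=> // e eh cove.
have d'h i (i_n : i < n) : d' i <= h by have /andP[] := sd' i i_n.
rewrite (residual_cost_reduce d'h g'E) (residual_cost_reduce eh g'E) mulrDr.
(* On the subtracted cost, [weight_minimal] bounds [d'] by [4 * nreleases] times the excess, and by
   [weight_cover] every cover [e] pays at least the excess. *)
apply: lerD; last first.
  rewrite mulrCA -natrM ler_wpM2l // ler_nat.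
  apply: leq_trans (weight_minimal (d := d') _ cov' min' maxD) _.
    by move=> i /sd' /andP[].
  rewrite leq_mul2l; apply/orP; right; exact: weight_cover.
(* On the remaining cost, putting [j] back does no harm: [g' j (s j)] is not positive, while
   [g' j (d j)] is nonnegative. *)
apply: le_trans (opt e eh cove).
apply: ler_sum => i _; case: d'P => -[-> _] //; rewrite /set_at.
case: eqVneq => [ij|//].
have [sj gj] := sh j jn.
rewrite ij [leLHS]g'E // /reduce /affected gj; case: ifP => [|_]; first by lia.
by rewrite -ij g'0 //; have /andP[] := sd0 i (ltn_ord i).
Qed.

End LocalRatio.

(** * Schedules *)

Section EarliestDueDate.
Variables (n : nat) (p r d : nat -> nat).
Hypothesis p_gt0 : forall j, j < n -> 0 < p j.
Hypothesis d_covers : covers n p r d.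

(* [l] lists the pairs (job, slot) worked on before time [u]. *)
Definition edd_inv u (rem : nat -> nat) (l : seq (nat * nat)) : Prop :=
  [/\ forall t, u <= t -> \sum_(j < n | d j <= t) rem j <= t - u,
      forall j, j < n -> u <= r j -> rem j = p j,
      forall j, j < n -> rem j + count (fun x : nat * nat => x.1 == j) l = p j,
      uniq [seq x.2 | x <- l]
    & forall x : nat * nat, x \in l ->
        [&& x.1 < n, r x.1 <= x.2, x.2 < d x.1 & x.2 < u]].

Lemma edd_inv0 rem : (forall j, j < n -> rem j = p j) -> edd_inv 0 rem [::].
Proof.
move=> remE; split=> // [t _|j jn _|j jn].
- rewrite (eq_bigr (fun j : 'I_n => p j)) => [|j _]; last exact: remE.
  exact: (covers_load p_gt0 d_covers (leq0n t)).
- exact: remE.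
- by rewrite addn0 remE.
Qed.

(** All work left belongs to jobs released after [u], still untouched, and these fit by
    [covers_load] from [u.+1] on. *)
Lemma edd_inv_idle u rem l : edd_inv u rem l ->
  (forall j, j < n -> r j <= u -> rem j = 0) -> edd_inv u.+1 rem l.
Proof.
move=> [load_u rem_u cnt_l uniq_l l_ok] idle; split=> // [t ut|j jn uj|x xl].
- rewrite (bigID (fun j : 'I_n => r j <= u)) /= big1 ?add0n; last first.
    by move=> j /andP[_ rj]; apply: idle.
  apply: leq_trans (covers_load p_gt0 d_covers ut).
  rewrite [leqLHS]big_mkcond [leqRHS]big_mkcond; apply: leq_sum => j _.
  rewrite -ltnNge andbC; case: ifP => // /andP[uj _].
  by rewrite rem_u // ltnW.
- by apply: rem_u => //; apply: ltnW.
- by have := l_ok x xl; lia.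
Qed.

(** For [t] at or after [d j], one unit of work and one unit of time disappear together. For earlier
    [t], the choice of [j] means that no released job due by [t] has work left, and the argument is
    that of an idle slot. *)
Lemma edd_inv_work u rem l j : edd_inv u rem l ->
  j < n -> r j <= u -> 0 < rem j ->
  (forall i, i < n -> r i <= u -> 0 < rem i -> d j <= d i) ->
  edd_inv u.+1 (set_at rem j (rem j - 1)) (rcons l (j, u)).
Proof.
move=> [load_u rem_u cnt_l uniq_l l_ok] jn rj remj edd.
(* The invariant at [t = u] leaves no work for jobs due by [u]. *)
have dj : u < d j.
  rewrite ltnNge; apply/negP => dj; have := load_u u (leqnn u).
  by rewrite (bigD1 (Ordinal jn)) //= subnn; lia.
split=> [t ut|i i_n ui|i i_n||x].
- have [djt|djt] := leqP (d j) t.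
    have := load_u t (ltnW ut).
    rewrite (bigD1 (Ordinal jn)) //= [leqLHS in _ -> leqLHS <= _](bigD1 (Ordinal jn)) //=.
    rewrite [X in _ -> X + _ <= _]/set_at eqxx.
    rewrite [X in _ -> _ + X <= _](eq_bigr (fun i : 'I_n => rem i)); first by lia.
    by move=> i /andP[_]; rewrite /set_at -val_eqE /= => /negbTE ->.
  apply: leq_trans (covers_load p_gt0 d_covers ut).
  rewrite [leqLHS]big_mkcond [leqRHS]big_mkcond; apply: leq_sum => i _.
  case: (leqP (d i) t) => di; rewrite ?andbF // andbT /set_at.
  case: eqVneq => [ij|_]; first by move: djt; rewrite -ij ltnNge di.
  case: ltnP => ui; first by rewrite rem_u // ltnW.
  rewrite leqn0; case: (posnP (rem i)) => [//|pos].
  by have := edd i (ltn_ord i) ui pos; lia.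
- rewrite /set_at; case: eqVneq => [ij|_]; first by move: ui; rewrite ij; lia.
  by rewrite rem_u // ltnW.
- rewrite -cats1 count_cat /= addn0 /set_at [j == i]eq_sym.
  have := cnt_l i i_n; case: eqVneq => [ij|_]; rewrite ?ij; lia.
- rewrite map_rcons rcons_uniq uniq_l andbT; apply/mapP => -[x xl /= uE].
  by have := l_ok x xl; rewrite -uE ltnn !andbF.
- rewrite mem_rcons inE => /orP[/eqP ->|xl] /=; first by rewrite jn rj dj /=.
  by have := l_ok x xl; lia.
Qed.

(** At time [h] the invariant allows no remaining work due by [h], that is, none at all. *)
Lemma edd_inv_done h rem l : (forall j, j < n -> d j <= h) ->
  edd_inv h rem l ->
  forall j, j < n -> count (fun x : nat * nat => x.1 == j) l = p j.
Proof.
move=> dh [load_h _ cnt_l _ _] j jn; rewrite -(cnt_l j jn).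
have := load_h h (leqnn h); rewrite subnn (bigD1 (Ordinal jn)) ?dh //=.
by lia.
Qed.

End EarliestDueDate.

(** * Due dates versus continuous schedules *)

Section Schedules.
Variables (R : realType) (I : instance R).
Local Notation n := (njobs I).
Local Notation p := (input_nmem I 1).
Local Notation r := (input_nmem I 2).

Lemma input_ptime (j : 'I_n) : p j = ptime I j.
Proof. by rewrite /= valK. Qed.

Lemma input_rdate (j : 'I_n) : r j = rdate I j.
Proof. by rewrite /= valK. Qed.

Lemma cost_oracleE (j : 'I_n) t : cost_oracle I j t = jcost I j t%:R%R.
Proof. by rewrite /cost_oracle valK. Qed.

Lemma nreleases_input : nreleases n r = nrelease I.
Proof.
rewrite /nreleases /nrelease codomE -val_enum_ord -map_comp.
by congr (size (undup _)); apply: eq_map => j; exact: input_rdate.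
Qed.

Local Open Scope ring_scope.

(** The other intervals lie to the left or to the right of the first one, and both sides are bounded
    by induction on the length. *)
Lemma sum_disjoint (V : Type) (st sp : V -> R) (s : seq V) (a b : R) :
  a <= b ->
  all (fun x => (a <= st x) && (st x <= sp x) && (sp x <= b)) s ->
  pairwise (fun x y => (sp x <= st y) || (sp y <= st x)) s ->
  \sum_(x <- s) (sp x - st x) <= b - a.
Proof.
move: {2}(size s) (leqnn (size s)) => k.
elim: k s a b => [|k IH] [|x s] // a b sk ab; rewrite ?big_nil ?subr_ge0 //.
move=> /= /andP[/andP[/andP[ax xx] xb] all_s] /andP[x_s pw_s].
have {}sk : (size s <= k)%N := sk.
rewrite big_cons.
pose L y := sp y <= st x.
have -> : \sum_(y <- s) (sp y - st y) = \sum_(y <- [seq y <- s | L y]) (sp y - st y)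
    + \sum_(y <- [seq y <- s | ~~ L y]) (sp y - st y).
  by rewrite !big_filter [LHS](bigID L).
have left : \sum_(y <- [seq y <- s | L y]) (sp y - st y) <= st x - a.
  apply: IH => //; last exact: pairwise_filter.
    by rewrite size_filter (leq_trans (count_size _ _)).
  rewrite all_filter; apply: sub_all all_s => y /andP[/andP[ay yy] _].
  by apply/implyP => Ly; rewrite ay yy.
have right : \sum_(y <- [seq y <- s | ~~ L y]) (sp y - st y) <= b - sp x.
  apply: IH => //; last exact: pairwise_filter.
    by rewrite size_filter (leq_trans (count_size _ _)).
  have : all (fun y => ((a <= st y) && (st y <= sp y) && (sp y <= b)) &&
     ((sp x <= st y) || (sp y <= st x))) s.
    by rewrite all_predI all_s x_s.
  rewrite all_filter; apply: sub_all => y /andP[/andP[/andP[ay yy] yb] xy].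
  by apply/implyP => Ly; move: xy; rewrite yy yb -/(L y) (negbTE Ly) orbF => ->.
by lra.
Qed.

(** A slot [t] becomes the piece from [t] to [t + 1]: distinct slots give disjoint pieces, and a
    slot before the due date ends by the due date. *)
Lemma unit_schedule (d : nat -> nat) (l : seq (nat * nat)) :
  (forall x : nat * nat, x \in l ->
    [&& (x.1 < n)%N, (r x.1 <= x.2)%N & (x.2 < d x.1)%N]) ->
  uniq [seq x.2 | x <- l] ->
  (forall j, (j < n)%N -> count (fun x : nat * nat => x.1 == j) l = p j) ->
  exists S : schedule I,
    [/\ [seq (val (pjob x), pstart x, pstop x) | x <- S] =
          [seq (x.1, x.2%:R, x.2.+1%:R) | x <- l],
        feasible S & forall j, completion S j <= (d j)%:R].
Proof.
move=> l_ok uniq_l cnt_l.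
have [u [lE u_ok]] : exists u : seq ('I_n * nat),
    l = [seq (val x.1, x.2) | x <- u] /\
    forall x, x \in u -> (r x.1 <= x.2)%N && (x.2 < d x.1)%N.
  elim: l l_ok {uniq_l cnt_l} => [|[j t] l IH] l_ok; first by exists [::].
  have [|u [-> u_ok]] := IH; first by move=> x xl; apply: l_ok; rewrite inE xl orbT.
  have /and3P[/= jn rj dj] := l_ok (j, t) (mem_head _ _).
  exists ((Ordinal jn, t) :: u); split=> //= x.
  by rewrite inE => /orP[/eqP ->|/u_ok //]; rewrite rj.
pose S : schedule I := [seq (x.1, x.2%:R, x.2.+1%:R) | x <- u].
have mem_S x : x \in S -> exists2 y, y \in u & x = (y.1, y.2%:R, y.2.+1%:R).
  by move=> /mapP.
exists S; split.
- by rewrite lE -!map_comp; apply: eq_map.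
- split.
  + move=> x /mem_S[y yu ->]; rewrite /pjob /pstart /pstop /= ltr_nat ltnSn.
    by rewrite -input_rdate ler_nat; have /andP[] := u_ok y yu.
  + move: uniq_l; rewrite lE -map_comp uniq_pairwise !pairwise_map.
    apply: sub_pairwise => x y /=; rewrite /pstop /pstart /= !ler_nat.
    by case: ltngtP.
  + move=> j; rewrite big_map /pjob /pstart /pstop /= -input_ptime -cnt_l //.
    rewrite lE count_map -sum1_count natr_sum; apply: eq_big => x //= _.
    by rewrite -natr1 addrAC subrr add0r.
- move=> j; rewrite /completion big_seq_cond; apply: bigmax_le => // x.
  move=> /andP[/mem_S[y yu ->] /eqP <-]; rewrite /pstop /pjob /= ler_nat.
  by have /andP[] := u_ok y yu.
Qed.

(** Rounding completion times down does not raise the cost; the cap [h] keeps the dates inside the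
    table. *)
Definition integral_dues (S : schedule I) (h i : nat) : nat :=
  if insub i is Some j then minn (Num.trunc (completion S j)) h else 0%N.

Lemma completion_ge0 (S : schedule I) j : 0 <= completion S j.
Proof. by rewrite /completion; apply: bigmax_ge_id. Qed.

Lemma integral_dues_le (S : schedule I) h i : (integral_dues S h i <= h)%N.
Proof. by rewrite /integral_dues; case: insub => // j; apply: geq_minr. Qed.

Lemma integral_dues_completion (S : schedule I) h (j : 'I_n) :
  (integral_dues S h j)%:R <= completion S j.
Proof.
rewrite /integral_dues valK; apply: le_trans (_ : (Num.trunc (completion S j))%:R <= _).
  by rewrite ler_nat geq_minl.
by rewrite truncn_le completion_ge0.
Qed.

(* The jobs released from [r k] on with [trunc C <= t] are processed within an
   interval whose right end is less than [t + 1]; as processing times are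
   integers, they take at most [t - r k]. *)
Lemma integral_dues_covers (S : schedule I) h : feasible S ->
  (forall k, (k < n)%N -> (r k + \sum_(j < n) p j <= h)%N) ->
  covers n p r (integral_dues S h).
Proof.
move=> [S_rel S_disj S_proc] le_h k t kn.
(* There is no excess from [h] on; before [h], the cap does not affect the comparison with [t]. *)
have [ht|th] := leqP h t; first exact: excess_horizon (le_h k kn) ht.
apply/eqP; rewrite subn_eq0.
pose J (j : 'I_n) := (r k <= r j)%N && (integral_dues S h j <= t)%N.
have JC j : J j -> completion S j < t.+1%:R.
  rewrite /J /integral_dues valK => /andP[_]; rewrite geq_min [(h <= _)%N]leqNgt th orbF.
  by rewrite truncn_le_nat.
have loadE : (load n p r (integral_dues S h) k t)%:R =
    \sum_(x <- [seq x <- S | J (pjob x)]) (pstop x - pstart x).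
  rewrite /load natr_sum big_filter.
  rewrite (partition_big (fun x : piece R n => pjob x) J) //.
  apply: eq_bigr => j Jj; rewrite input_ptime -S_proc.
  by apply: eq_bigl => x; case: eqVneq => [->|]; rewrite ?andbT ?andbF.
pose b := \big[Num.max/(r k)%:R]_(x <- [seq x <- S | J (pjob x)]) pstop x.
have rkb : (r k)%:R <= b by apply: bigmax_ge_id.
have [E|nonempty] := eqVneq [seq x <- S | J (pjob x)] [::].
  by move: loadE; rewrite E big_nil => /eqP; rewrite pnatr_eq0 => /eqP ->.
have stop_lt x : x \in S -> J (pjob x) -> pstop x < t.+1%:R.
  move=> xS Jx; apply: le_lt_trans (JC _ Jx).
  by rewrite /completion; apply: (le_bigmax_seq _ x).
have start_ge x : x \in S -> J (pjob x) -> (r k)%:R <= pstart x.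
  move=> xS /andP[rkx _]; have [rx _] := S_rel x xS.
  by apply: le_trans rx; rewrite -input_rdate ler_nat.
(* The maximum [b] has default value [r k], so [b < t + 1] requires this too; any of the selected
   pieces witnesses it. *)
have rkt : (r k)%:R < t.+1%:R :> R.
  case: [seq x <- S | J (pjob x)] (mem_filter (fun x => J (pjob x))^~ S) nonempty
    => // x s xs _.
  have := xs x; rewrite mem_head => /esym/andP[Jx xS].
  have [_ xx] := S_rel x xS.
  exact: le_lt_trans (start_ge x xS Jx) (lt_trans xx (stop_lt x xS Jx)).
have bt : b < t.+1%:R.
  rewrite /b big_filter big_seq_cond; apply: bigmax_lt => // x /andP[xS Jx].
  exact: stop_lt.
have : \sum_(x <- [seq x <- S | J (pjob x)]) (pstop x - pstart x) <= b - (r k)%:R.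
  apply: sum_disjoint => //; last exact: pairwise_filter.
  apply/allP => x; rewrite mem_filter => /andP[Jx xS].
  rewrite start_ge //= ltW /=; last by have [] := S_rel x xS.
  by apply: (le_bigmax_seq _ x); rewrite ?mem_filter ?Jx.
rewrite -loadE => load_b.
(* Between integers, being less than [t + 1] means being at most [t]. *)
have : (load n p r (integral_dues S h) k t)%:R + (r k)%:R < t.+1%:R :> R by lra.
by rewrite -natrD ltr_nat; lia.
Qed.

End Schedules.

(** * Programs with bounded loops *)

(** A fragment of [cmd] with counted loops only, so that halting and running time follow from the
    syntax. *)
Inductive prog : Type :=
| PN of nat & nexp & nexp
| PR of nat & nexp & rexp
| PSeq of prog & prog
| PIf of bexp & prog & prog
| PSkip
| PFor of nat & nat & prog.

(* [PFor i b c]: the counter is cell 0 of array [i], the bound is cell 0 of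
   array [b]. *)
Fixpoint compile (c : prog) : cmd :=
  match c with
  | PN a i e => NSet a i e
  | PR a i e => RSet a i e
  | PSeq c1 c2 => Seq (compile c1) (compile c2)
  | PIf b c1 c2 => If b (compile c1) (compile c2)
  | PSkip => Skip
  | PFor i b c1 =>
      Seq (NSet i (NConst 0) (NConst 0))
        (While (BNot (BNLe (NGet b (NConst 0)) (NGet i (NConst 0))))
           (Seq (compile c1)
              (NSet i (NConst 0) (NAdd (NGet i (NConst 0)) (NConst 1)))))
  end.

Fixpoint nwrites (c : prog) : seq nat :=
  match c with
  | PN a _ _ => [:: a]
  | PSeq c1 c2 | PIf _ c1 c2 => nwrites c1 ++ nwrites c2
  | PFor i _ c1 => i :: nwrites c1
  | _ => [::]
  end.

Fixpoint rwrites (c : prog) : seq nat :=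
  match c with
  | PR a _ _ => [:: a]
  | PSeq c1 c2 | PIf _ c1 c2 => rwrites c1 ++ rwrites c2
  | PFor _ _ c1 => rwrites c1
  | _ => [::]
  end.

Fixpoint bounds (c : prog) : seq nat :=
  match c with
  | PSeq c1 c2 | PIf _ c1 c2 => bounds c1 ++ bounds c2
  | PFor _ b c1 => b :: bounds c1
  | _ => [::]
  end.

Fixpoint counters_ok (c : prog) : bool :=
  match c with
  | PSeq c1 c2 | PIf _ c1 c2 => counters_ok c1 && counters_ok c2
  | PFor i _ c1 => (i \notin nwrites c1) && counters_ok c1
  | _ => true
  end.

(** No loop body writes its counter, and no loop bound is written anywhere in the program, so bounds
    keep their initial values throughout. *)
Definition wf (c : prog) : bool :=
  counters_ok c && all (fun b => b \notin nwrites c) (bounds c).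

(** [B] stands for a common bound on all loop bounds. Each iteration adds a test and an increment,
    each loop an initialisation and a final test; a conditional is charged for both branches. *)
Fixpoint time (B : nat) (c : prog) : nat :=
  match c with
  | PSeq c1 c2 => time B c1 + time B c2
  | PIf _ c1 c2 => (time B c1 + time B c2).+1
  | PFor _ _ c1 => B * (time B c1 + 2) + 2
  | _ => 1
  end.

Lemma time_polynomial c : exists a d, forall B, time B c <= a * B.+1 ^ d.
Proof.
have one B d : 0 < B.+1 ^ d by rewrite expn_gt0.
elim: c => [a i e|a i e|c1 [a1 [d1 H1]] c2 [a2 [d2 H2]]
  |b c1 [a1 [d1 H1]] c2 [a2 [d2 H2]]||i b c1 [a1 [d1 H1]]] /=.
- by exists 1, 0.
- by exists 1, 0.
- exists (a1 + a2), (d1 + d2) => B; rewrite mulnDl leq_add //.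
    by apply: leq_trans (H1 B) _; rewrite leq_mul2l leq_pexp2l ?leq_addr ?orbT.
  by apply: leq_trans (H2 B) _; rewrite leq_mul2l leq_pexp2l ?leq_addl ?orbT.
- exists (a1 + a2).+1, (d1 + d2) => B; rewrite mulSn mulnDl -add1n.
  rewrite leq_add ?leq_add //.
    by apply: leq_trans (H1 B) _; rewrite leq_mul2l leq_pexp2l ?leq_addr ?orbT.
  by apply: leq_trans (H2 B) _; rewrite leq_mul2l leq_pexp2l ?leq_addl ?orbT.
- by exists 1, 0.
- exists (a1 + 4), d1.+1 => B; have := H1 B; have := one B d1.
  rewrite expnS; set x := B.+1 ^ d1; nia.
Qed.

(** * Semantics, frame conditions and loop rules *)

Section Semantics.
Variables (R : realType) (oracle : nat -> nat -> R).
Implicit Types (m : memory R).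

Definition nset m a i v := Memory (update (nmem m) a i v) (rmem m).
Definition rset m a i v := Memory (nmem m) (update (rmem m) a i v).

(** A loop reads its bound once, on entry, whereas the compiled loop rereads it at every test;
    [exec_run] reconciles the two under [wf]. *)
Fixpoint run (c : prog) m : memory R :=
  match c with
  | PN a i e => nset m a (neval m i) (neval m e)
  | PR a i e => rset m a (neval m i) (reval oracle m e)
  | PSeq c1 c2 => run c2 (run c1 m)
  | PIf b c1 c2 => if beval oracle m b then run c1 m else run c2 m
  | PSkip => m
  | PFor i b c1 =>
      iter (nmem m b 0)
        (fun m' => let m1 := run c1 m' in nset m1 i 0 (nmem m1 i 0 + 1))
        (nset m i 0 0)
  end.

Definition agree (na ra : seq nat) m m' : Prop :=
  (forall a, a \notin na -> nmem m' a = nmem m a) /\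
  (forall a, a \notin ra -> rmem m' a = rmem m a).

Lemma agree_refl na ra m : agree na ra m m.
Proof. by []. Qed.

Lemma agree_trans na ra m1 m2 m3 :
  agree na ra m1 m2 -> agree na ra m2 m3 -> agree na ra m1 m3.
Proof.
move=> [n12 r12] [n23 r23].
by split=> a aP; [rewrite n23 ?n12|rewrite r23 ?r12].
Qed.

Lemma agree_sub na na' ra ra' m m' :
  {subset na <= na'} -> {subset ra <= ra'} ->
  agree na ra m m' -> agree na' ra' m m'.
Proof.
move=> sn sr [an ar]; split=> a aP; [apply: an|apply: ar].
  by apply: contra aP; apply: sn.
by apply: contra aP; apply: sr.
Qed.

Lemma update_other (T : Type) (f : nat -> nat -> T) a i v b :
  b != a -> update f a i v b = f b.
Proof. by rewrite /update => /negbTE ->. Qed.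

Lemma agree_nset na ra m a i v : a \in na -> agree na ra m (nset m a i v).
Proof.
move=> aP; split=> // b bP; rewrite /= update_other //.
by apply: contraNneq bP => ->.
Qed.

Lemma agree_rset na ra m a i v : a \in ra -> agree na ra m (rset m a i v).
Proof.
move=> aP; split=> // b bP; rewrite /= update_other //.
by apply: contraNneq bP => ->.
Qed.

Lemma agree_run c m : agree (nwrites c) (rwrites c) m (run c m).
Proof.
elim: c m => [a i e|a i e|c1 IH1 c2 IH2|b c1 IH1 c2 IH2||i b c1 IH1] m /=.
- by apply: agree_nset; rewrite inE.
- by apply: agree_rset; rewrite inE.
- apply: (@agree_trans _ _ _ (run c1 m)).
    by apply: agree_sub (IH1 m) => a aP; rewrite mem_cat aP.
  by apply: agree_sub (IH2 _) => a aP; rewrite mem_cat aP orbT.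
- case: ifP => _.
    by apply: agree_sub (IH1 m) => a aP; rewrite mem_cat aP.
  by apply: agree_sub (IH2 m) => a aP; rewrite mem_cat aP orbT.
- exact: agree_refl.
- elim: (nmem m b 0) => [|k IH]; first by apply: agree_nset; rewrite mem_head.
  apply: agree_trans IH _; set m' := iter k _ _; rewrite iterS -/m' /=.
  apply: (@agree_trans _ _ _ (run c1 m')).
    by apply: agree_sub (IH1 m') => // a aP; rewrite inE aP orbT.
  by apply: agree_nset; rewrite mem_head.
Qed.

Lemma iter_counter i c1 m k : i \notin nwrites c1 ->
  nmem (iter k (fun m' => let m1 := run c1 m' in
                          nset m1 i 0 (nmem m1 i 0 + 1)) (nset m i 0 0)) i 0 = k.
Proof.
move=> ic1; elim: k => [|k IH]; first by rewrite /= /update !eqxx.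
rewrite iterS; set m' := iter k _ _ in IH *.
by rewrite /= {1}/update !eqxx /= (agree_run c1 m').1 // IH addn1.
Qed.

Lemma exec_run (B : nat) (c : prog) m : wf c ->
  (forall b, b \in bounds c -> nmem m b 0 <= B) ->
  exists2 t, exec oracle (compile c) m t (run c m) & t <= time B c.
Proof.
(* [W] holds the arrays written by the whole program, so that the induction still knows in a
   subprogram that no bound is written. *)
suff gen (W : seq nat) : {subset nwrites c <= W} -> counters_ok c ->
    all (fun b => b \notin W) (bounds c) ->
    (forall b, b \in bounds c -> nmem m b 0 <= B) ->
    exists2 t, exec oracle (compile c) m t (run c m) & t <= time B c.
  by move=> /andP[ok all_c]; apply: gen all_c.
elim: c m => [a i e|a i e|c1 IH1 c2 IH2|b c1 IH1 c2 IH2||i b c1 IH1] m /= sW.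
- by exists 1 => //; apply: exec_nset.
- by exists 1 => //; apply: exec_rset.
- move=> /andP[ok1 ok2]; rewrite all_cat => /andP[all1 all2] mB.
  have sW1 a : a \in nwrites c1 -> a \in W by move=> aP; rewrite sW // mem_cat aP.
  have sW2 a : a \in nwrites c2 -> a \in W by move=> aP; rewrite sW // mem_cat aP orbT.
  have [|t1 e1 le1] := IH1 m sW1 ok1 all1.
    by move=> b bP; apply: mB; rewrite mem_cat bP.
  have [|t2 e2 le2] := IH2 (run c1 m) sW2 ok2 all2.
    move=> b bP; rewrite (agree_run c1 m).1; last first.
      by apply: contra (allP all2 _ bP); apply: sW1.
    by apply: mB; rewrite mem_cat bP orbT.
  by exists (t1 + t2); [apply: exec_seq e1 e2|apply: leq_add].
- move=> /andP[ok1 ok2]; rewrite all_cat => /andP[all1 all2] mB.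
  case bE: (beval oracle m b).
    have [||t e le] := IH1 m _ ok1 all1.
    + by move=> a aP; rewrite sW // mem_cat aP.
    + by move=> a aP; apply: mB; rewrite mem_cat aP.
    by exists t.+1; [apply: exec_if; rewrite bE|lia].
  have [||t e le] := IH2 m _ ok2 all2.
  + by move=> a aP; rewrite sW // mem_cat aP orbT.
  + by move=> a aP; apply: mB; rewrite mem_cat aP orbT.
  by exists t.+1; [apply: exec_if; rewrite bE|lia].
- by exists 1 => //; apply: exec_skip.
- move=> /andP[ic1 ok1] /andP[bW all1] mB.
  pose body m' := let m1 := run c1 m' in nset m1 i 0 (nmem m1 i 0 + 1).
  pose it k := iter k body (nset m i 0 0).
  have sW1 a : a \in nwrites c1 -> a \in W by move=> aP; rewrite sW // inE aP orbT.
  have agr k : agree W (rwrites c1) m (it k).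
    elim: k => [|k IH]; first by apply: agree_nset; rewrite sW ?mem_head.
    apply: agree_trans IH _; rewrite /it iterS -/(it k) /body.
    apply: (@agree_trans _ _ _ (run c1 (it k))); last first.
      by apply: agree_nset; rewrite sW ?mem_head.
    by apply: agree_sub (agree_run c1 _).
  have itB b' k : b' \in bounds c1 -> nmem (it k) b' 0 <= B.
    move=> bP; rewrite (agr k).1; last exact: (allP all1).
    by apply: mB; rewrite inE bP orbT.
  set N := nmem m b 0; have NB : N <= B by apply: mB; rewrite mem_head.
  have iti k : nmem (it k) i 0 = k by apply: iter_counter.
  have bE k : nmem (it k) b 0 = N by rewrite (agr k).1.
  (* Induction on the number [l] of iterations still to be made. *)
  have loop l : l <= N -> exists2 t,
      exec oracle (While (BNot (BNLe (NGet b (NConst 0)) (NGet i (NConst 0))))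
         (Seq (compile c1)
            (NSet i (NConst 0) (NAdd (NGet i (NConst 0)) (NConst 1)))))
        (it (N - l)) t (it N) & t <= l * (time B c1 + 2) + 1.
    elim: l => [|l IH] lN.
      exists 1 => //; rewrite subn0; apply: exec_while_false => /=.
      by rewrite negbK iti bE.
    have [|t2 e2 le2] := IH; first exact: ltnW.
    have [|t1 e1 le1] := IH1 (it (N - l.+1)) sW1 ok1 all1.
      by move=> b' bP; apply: itB.
    exists (t1 + 1 + t2).+1; last by lia.
    apply: exec_while_true; [|apply: exec_seq; [exact: e1|exact: exec_nset]|].
      by rewrite /= iti bE -ltnNge; lia.
    suff itE : it (N - l) = nset (run c1 (it (N - l.+1))) i 0
        (nmem (run c1 (it (N - l.+1))) i 0 + 1) by rewrite itE in e2; exact: e2.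
    by rewrite [in LHS](_ : N - l = (N - l.+1).+1); last lia.
  have [|t e le] := loop N => //.
  rewrite subnn in e.
  exists (1 + t); first by apply: exec_seq e; apply: exec_nset.
  by have := leq_mul2r (time B c1 + 2) N B; rewrite NB orbT; lia.
Qed.

(** The Hoare rule for counted loops. The invariant takes the iteration number as an argument and
    must not depend on the counter cell, hence the stability hypothesis. *)
Lemma run_for i b c m (P : nat -> memory R -> Prop) : i \notin nwrites c ->
  (forall k m' v, P k m' -> P k (nset m' i 0 v)) -> P 0 m ->
  (forall k m', k < nmem m b 0 -> agree (i :: nwrites c) (rwrites c) m m' ->
     nmem m' i 0 = k -> P k m' -> P k.+1 (run c m')) ->
  P (nmem m b 0) (run (PFor i b c) m).
Proof.
move=> ic stable P0 step /=; move: (leqnn (nmem m b 0)).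
suff : forall k, k <= nmem m b 0 -> let m' := iter k
    (fun m' => let m1 := run c m' in nset m1 i 0 (nmem m1 i 0 + 1)) (nset m i 0 0)
  in P k m' /\ agree (i :: nwrites c) (rwrites c) m m'.
  by move=> H kN; have [] := H _ kN.
elim=> [|k IH] kN.
  by split; [exact: stable|apply: agree_nset; rewrite mem_head].
have := iter_counter m k ic; rewrite iterS; have /= := IH (ltnW kN).
set m' := iter k _ _ => -[Pk ak] ik; split.
  by apply: stable; apply: step.
apply: agree_trans ak _; apply: (@agree_trans _ _ _ (run c m')).
  by apply: agree_sub (agree_run c m') => // a aP; rewrite inE aP orbT.
by apply: agree_nset; rewrite mem_head.
Qed.

(** The rule for two nested loops, with one invariant for both; the condition before the last
    carries it from the end of a row to the start of the next. *)
Lemma run_for2 i1 b1 i2 b2 c m (P : nat -> nat -> memory R -> Prop) :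
  [&& i1 \notin i2 :: nwrites c, i2 \notin nwrites c & b2 \notin [:: i1, i2 & nwrites c]] ->
  (forall k l m' v, P k l m' -> P k l (nset m' i1 0 v)) ->
  (forall k l m' v, P k l m' -> P k l (nset m' i2 0 v)) -> P 0 0 m ->
  (forall k m', k < nmem m b1 0 -> P k (nmem m b2 0) m' -> P k.+1 0 m') ->
  (forall k l m', k < nmem m b1 0 -> l < nmem m b2 0 ->
     agree [:: i1, i2 & nwrites c] (rwrites c) m m' ->
     nmem m' i1 0 = k -> nmem m' i2 0 = l -> P k l m' -> P k l.+1 (run c m')) ->
  P (nmem m b1 0) 0 (run (PFor i1 b1 (PFor i2 b2 c)) m).
Proof.
move=> /and3P[i1c i2c b2c] stable1 stable2 P0 next step.
refine (run_for (c := PFor i2 b2 c) (P := fun k => P k 0) i1c (fun k => stable1 k 0) P0 _).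
move=> k m1 kN a1 i1k Pk.
apply: next => //; have <- : nmem m1 b2 0 = nmem m b2 0 by rewrite a1.1.
refine (run_for (P := fun l => P k l) i2c (stable2 k) Pk _).
move=> l m2 lN a2 i2l Pl.
apply: step => //; first by rewrite -(a1.1 b2).
  by apply: agree_trans a1 _; apply: agree_sub a2 => // a aP; rewrite inE aP orbT.
by rewrite (a2.1 i1).
Qed.

End Semantics.

(** * The algorithm *)

Section Program.

Local Notation NJ := 0.      (* number of jobs *)
Local Notation PT := 1.      (* processing times *)
Local Notation RD := 2.      (* release dates *)
Local Notation OUTC := 3.
Local Notation OUTJ := 4.
Local Notation OUTS := 5.
Local Notation OUTE := 6.
Local Notation HZ := 7.      (* horizon + 1 *)
Local Notation NH := 8.      (* NJ * HZ *)
Local Notation OFF := 9.     (* OFF[j] = j * HZ *)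
Local Notation DUE := 10.    (* due dates *)
Local Notation LOGC := 11.   (* size of the log of pushes *)
Local Notation LOGJ := 12.   (* logged jobs *)
Local Notation LOGD := 13.   (* logged former due dates *)
Local Notation XS := 14.     (* largest excess *)
Local Notation XR := 15.     (* its release date *)
Local Notation XT := 16.     (* its time *)
Local Notation ACC := 17.
Local Notation SEL := 18.    (* selected job *)
Local Notation SELD := 19.   (* its new due date *)
Local Notation FOUND := 20.
Local Notation REM := 21.    (* remaining processing times *)
Local Notation OLD := 22.
Local Notation WT := 23.     (* weight *)
Local Notation CI := 24.     (* loop counters *)
Local Notation CK := 25.
Local Notation CT := 26.
Local Notation CJ := 27.
Local Notation RES := 0.     (* residual costs, at OFF[j] + t *)
Local Notation ALPHA := 1.
Local Notation RATIO := 2.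

Local Notation var a := (NGet a (NConst 0)).
Local Notation assign a e := (PN a (NConst 0) e).
Local Notation when b c := (PIf b c PSkip).
Local Notation incr a := (assign a (NAdd (var a) (NConst 1))).
Local Notation "c1 ;; c2" := (PSeq c1 c2) (at level 60, right associativity).

(** [XR] and [ACC] serve as scratch cells for the largest release date and the total processing
    time. Expressions have no product of naturals, so the multiples of [HZ] are found by repeated
    addition. *)
Definition prelude : prog :=
  PFor CK NJ
    (when (BNot (BNLe (NGet RD (var CK)) (var XR))) (assign XR (NGet RD (var CK))) ;;
     assign ACC (NAdd (var ACC) (NGet PT (var CK)))) ;;
  assign HZ (NAdd (NAdd (var XR) (var ACC)) (NConst 1)) ;;
  PFor CK NJ (PN OFF (var CK) (var NH) ;; assign NH (NAdd (var NH) (var HZ))).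

(** Date 0 keeps residual cost 0, whatever the cost functions are there, so that the initial due
    dates are free; due dates that cover are positive. *)
Definition init_residual : prog :=
  PFor CJ NJ (PFor CT HZ
    (when (BNLe (NConst 1) (var CT))
       (PR RES (NAdd (NGet OFF (var CJ)) (var CT)) (RCost (var CJ) (var CT))))).

Definition compute_excess : prog :=
  assign ACC (NConst 0) ;;
  PFor CJ NJ
    (when (BAnd (BNLe (NGet RD (var CK)) (NGet RD (var CJ)))
                (BNLe (NGet DUE (var CJ)) (var CT)))
       (assign ACC (NAdd (var ACC) (NGet PT (var CJ))))) ;;
  assign ACC (NSub (var ACC) (NSub (var CT) (NGet RD (var CK)))).

Definition find_max_excess : prog :=
  assign XS (NConst 0) ;;
  PFor CK NJ (PFor CT HZ
    (compute_excess ;;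
     when (BNot (BNLe (var ACC) (var XS)))
       (assign XS (var ACC) ;; assign XR (NGet RD (var CK)) ;;
        assign XT (var CT)))).

Definition affected_test : bexp :=
  BAnd (BNLe (var XR) (NGet RD (var CJ)))
    (BAnd (BNLe (NGet DUE (var CJ)) (var XT))
       (BNLe (NAdd (var XT) (NConst 1)) (var CT))).

Definition compute_weight : prog :=
  assign WT (NGet PT (var CJ)) ;;
  when (BNLe (var XS) (var WT)) (assign WT (var XS)).

Definition residual : rexp := RGet RES (NAdd (NGet OFF (var CJ)) (var CT)).

(** The least ratio of residual cost to weight is the largest admissible multiple. [FOUND] tells
    whether [ALPHA] holds a candidate yet. *)
Definition select : prog :=
  assign FOUND (NConst 0) ;;
  PFor CJ NJ (PFor CT HZ
    (when affected_test
      (compute_weight ;;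
       PR RATIO (NConst 0) (RDivn residual (var WT)) ;;
       when (BNot (BAnd (BNLe (NConst 1) (var FOUND))
                        (BRLe (RGet ALPHA (NConst 0)) (RGet RATIO (NConst 0)))))
         (assign FOUND (NConst 1) ;; assign SEL (var CJ) ;; assign SELD (var CT) ;;
          PR ALPHA (NConst 0) (RGet RATIO (NConst 0)))))).

Definition reduce_residual : prog :=
  PFor CJ NJ (PFor CT HZ
    (when affected_test
      (compute_weight ;;
       PR RES (NAdd (NGet OFF (var CJ)) (var CT))
         (RSub residual (RMuln (RGet ALPHA (NConst 0)) (var WT)))))).

Definition push_selected : prog :=
  PN LOGJ (var LOGC) (var SEL) ;;
  PN LOGD (var LOGC) (NGet DUE (var SEL)) ;;
  incr LOGC ;;
  PN DUE (var SEL) (var SELD).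

Definition forward : prog :=
  PFor CI NH
    (find_max_excess ;;
     when (BNLe (NConst 1) (var XS))
       (select ;; reduce_residual ;; push_selected)).

Definition backward : prog :=
  PFor CI NH
    (when (BNLe (NConst 1) (var LOGC))
       (assign LOGC (NSub (var LOGC) (NConst 1)) ;;
        assign SEL (NGet LOGJ (var LOGC)) ;;
        assign OLD (NGet DUE (var SEL)) ;;
        PN DUE (var SEL) (NGet LOGD (var LOGC)) ;;
        find_max_excess ;;
        when (BNLe (NConst 1) (var XS)) (PN DUE (var SEL) (var OLD)))).

Definition select_edd : prog :=
  assign FOUND (NConst 0) ;;
  PFor CJ NJ
    (when (BAnd (BAnd (BNLe (NGet RD (var CJ)) (var CT))
                      (BNLe (NConst 1) (NGet REM (var CJ))))
                (BNot (BAnd (BNLe (NConst 1) (var FOUND))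
                  (BNLe (NGet DUE (var SEL)) (NGet DUE (var CJ))))))
       (assign FOUND (NConst 1) ;; assign SEL (var CJ))).

Definition edd : prog :=
  PFor CK NJ (PN REM (var CK) (NGet PT (var CK))) ;;
  PFor CT HZ
    (select_edd ;;
     when (BNLe (NConst 1) (var FOUND))
       (PN REM (var SEL) (NSub (NGet REM (var SEL)) (NConst 1)) ;;
        PN OUTJ (var OUTC) (var SEL) ;;
        PN OUTS (var OUTC) (var CT) ;;
        PN OUTE (var OUTC) (NAdd (var CT) (NConst 1)) ;;
        incr OUTC)).

(** Kept apart from [prelude], which writes the loop bounds [HZ] and [NH]: the composition of the
    two is not [wf]. *)
Definition main_prog : prog := init_residual ;; forward ;; backward ;; edd.

(** * Correctness of the phases *)

Section Correctness.
Variables (R : realType) (oracle : nat -> nat -> R).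
Variables (n h : nat) (p r : nat -> nat).
Implicit Types (m : memory R).
Local Notation run := (run oracle).

Definition env m : Prop :=
  [/\ nmem m NJ 0 = n, nmem m PT = p, nmem m RD = r
    & [/\ nmem m HZ 0 = h.+1, nmem m NH 0 = n * h.+1
        & forall j, j < n -> nmem m OFF j = j * h.+1]].

Lemma env_agree na ra m m' : agree na ra m m' ->
  ~~ has (mem na) [:: NJ; PT; RD; HZ; NH; OFF] -> env m -> env m'.
Proof.
move=> [ag _] /hasPn out; rewrite /env.
by rewrite !ag //; apply: out; rewrite !inE eqxx ?orbT.
Qed.

(** The lexicographic order in which a double loop meets the pairs. *)
Definition visited (k l k' l' : nat) := (k' < k) || ((k' == k) && (l' < l)).

Lemma visited_next k k' l' : l' < h.+1 -> visited k.+1 0 k' l' = visited k h.+1 k' l'.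
Proof. by rewrite /visited; lia. Qed.

Lemma visited_step k l k' l' :
  visited k l.+1 k' l' = visited k l k' l' || ((k' == k) && (l' == l)).
Proof. by rewrite /visited; lia. Qed.

Lemma run_seq c1 c2 m : run (PSeq c1 c2) m = run c2 (run c1 m).
Proof. by []. Qed.

Lemma run_when b c m : run (when b c) m = if beval oracle m b then run c m else m.
Proof. by []. Qed.

Lemma run_compute_excess m : env m -> nmem m CK 0 < n ->
  nmem (run compute_excess m) ACC 0 =
    excess n p r (nmem m DUE) (nmem m CK 0) (nmem m CT 0).
Proof.
move=> [mn mp mr _] kn; rewrite /compute_excess 2!run_seq.
set m0 := run (assign ACC (NConst 0)) m; set loop := PFor _ _ _.
have [agn _] := agree_run oracle loop m0.
pose P j m' := nmem m' ACC 0 =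
  \sum_(i < j | (r (nmem m CK 0) <= r i) && (nmem m DUE i <= nmem m CT 0)) p i.
suff : P (nmem m0 NJ 0) (run loop m0).
  move: (run loop m0) agn => m1 agn; rewrite /P /= => ->.
  by rewrite (agn CT isT) (agn RD isT) (agn CK isT) /m0 /= /update /= mr mn.
apply: (run_for (P := P)) => //; first by rewrite /P big_ord0.
move=> k m' _ [ag _] mJ H; rewrite /P big_mkcond big_ord_recr /= -big_mkcond.
rewrite (ag RD isT) (ag CK isT) (ag DUE isT) (ag CT isT) /m0 /= /update /= mJ mr.
case: ifP => _; last by rewrite addn0 H.
by rewrite /= /update /= H (ag PT isT) /m0 /= /update /= mp.
Qed.

Hypothesis le_h : forall k, k < n -> r k + \sum_(j < n) p j <= h.

Lemma run_find_max_excess m : env m ->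
  let m' := run find_max_excess m in
  (forall k t, k < n ->
     excess n p r (nmem m DUE) k t <= nmem m' XS 0) /\
  (0 < nmem m' XS 0 -> exists k, [/\ k < n, nmem m' XR 0 = r k
     & nmem m' XS 0 = excess n p r (nmem m DUE) k (nmem m' XT 0)]).
Proof.
move=> env_m; rewrite /find_max_excess run_seq.
set m0 := run _ m; set body := (X in PFor CK NJ (PFor CT HZ X)).
set d := nmem m DUE; pose ex := excess n p r d.
have env0 : env m0 by exact: (env_agree (agree_run oracle _ m)).
have [d0 x0] : nmem m0 DUE = d /\ nmem m0 XS 0 = 0 by [].
have [m0n _ _ [m0h _ _]] := env0.
pose P k l m' := (forall k' l', k' < n -> l' < h.+1 -> visited k l k' l' ->
    ex k' l' <= nmem m' XS 0) /\
  (0 < nmem m' XS 0 -> exists k', [/\ k' < n, nmem m' XR 0 = r k'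
     & nmem m' XS 0 = ex k' (nmem m' XT 0)]).
suff : P (nmem m0 NJ 0) 0 (run (PFor CK NJ (PFor CT HZ body)) m0).
  move: (run (PFor _ _ _) m0) => m1 [le_x x_pos]; split=> // k t kn.
  (* The search stops at [h], beyond which there is no excess. *)
  have [ht|th] := leqP h t; first by rewrite (excess_horizon _ (le_h kn) ht).
  by apply: le_x; rewrite // /visited ?m0n ?kn // ltnW.
apply: (run_for2 (P := P)) => //.
- by split=> [k' l' _ _|]; rewrite ?x0 // /visited !ltn0 andbF.
- rewrite m0h => k m' _ [le_x x_pos]; split=> // k' l' k'n l'h.
  by rewrite visited_next //; apply: le_x.
move=> k l m'; rewrite m0n m0h => kn lh ag mK mT [le_x x_pos].
have env' : env m' by exact: (env_agree ag).
rewrite /body run_seq.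
have xE := run_compute_excess env'; have [ag1 _] := agree_run oracle compute_excess m'.
move: (run compute_excess m') xE ag1 => m1 xE ag1.
have {}xE : nmem m1 ACC 0 = ex k l.
  by rewrite xE ?mK // mT (ag.1 DUE isT) d0.
have [_ _ mr _] := env'.
have [xs1 xr1 xt1] : [/\ nmem m1 XS 0 = nmem m' XS 0, nmem m1 XR 0 = nmem m' XR 0
    & nmem m1 XT 0 = nmem m' XT 0] by rewrite !ag1.
have rk : nmem m1 RD (nmem m1 CK 0) = r k by rewrite !ag1 // mK mr.
have t1 : nmem m1 CT 0 = l by rewrite ag1.
rewrite /= xE xs1; case: leqP => /= cmp; split=> /=.
- move=> k' l' k'n l'h; rewrite xs1 visited_step => /orP[|/andP[/eqP -> /eqP ->] //].
  exact: le_x.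
- by rewrite xs1 xr1 xt1.
- move=> k' l' k'n l'h; rewrite /update /=.
  rewrite visited_step => /orP[|/andP[/eqP -> /eqP ->] //].
  by move=> /(le_x _ _ k'n l'h) /leq_trans; apply; apply: ltnW.
- by rewrite /update /= rk t1 => _; exists k.
Qed.

Hypothesis p_gt0 : forall j, j < n -> 0 < p j.

Definition res m j u : R := rmem m RES (j * h.+1 + u).

Variant violated k m : Prop :=
  Violated of env m & k < n & nmem m XR 0 = r k & 0 < nmem m XS 0
    & nmem m XS 0 = excess n p r (nmem m DUE) k (nmem m XT 0).

Lemma violated_agree na ra m m' k : agree na ra m m' ->
  ~~ has (mem na) [:: NJ; PT; RD; HZ; NH; OFF; DUE; XR; XS; XT] ->
  violated k m -> violated k m'.
Proof.
move=> ag out [env_m kn xr xs xsE].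
have eq_a a : a \in [:: NJ; PT; RD; HZ; NH; OFF; DUE; XR; XS; XT] ->
    nmem m' a = nmem m a.
  by move=> /(hasPn out) /=; apply: ag.1.
split=> //; rewrite ?eq_a //; apply: (env_agree ag) env_m.
by apply/hasPn => a aP; apply: (hasPn out); apply: (mem_subseq _ aP).
Qed.

Lemma run_affected_test k m : violated k m ->
  beval oracle m affected_test =
    affected r (nmem m DUE) k (nmem m XT 0) (nmem m CJ 0) (nmem m CT 0).
Proof. by move=> [[_ _ mr _] _ xr _ _]; rewrite /= /affected mr xr addn1. Qed.

Lemma run_compute_weight k m : violated k m ->
  nmem (run compute_weight m) WT 0 = weight p (nmem m XS 0) (nmem m CJ 0).
Proof.
move=> [[_ mp _ _] _ _ _ _]; rewrite /= /update /= mp /weight.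
by case: leqP => /=; rewrite /update /= ?mp.
Qed.

Lemma violated_horizon k m : violated k m -> nmem m XT 0 < h.
Proof.
move=> [_ kn _ pos xsE]; rewrite ltnNge; apply/negP => ht.
by move: pos; rewrite xsE (excess_horizon _ (le_h kn) ht).
Qed.

(** A positive excess counts some job, and date [h] is a candidate for it as [t < h]. Hence [select]
    always finds an entry. *)
Lemma violated_affected k m : violated k m -> exists2 j, j < n &
  affected r (nmem m DUE) k (nmem m XT 0) j h.
Proof.
move=> viol; have th := violated_horizon viol.
have [_ _ _ pos xsE] := viol; move: pos; rewrite xsE /excess /load /affected th.
case: (pickP (fun j : 'I_n => (r k <= r j) && (nmem m DUE j <= nmem m XT 0))).
  by move=> j jP _; exists j => //; rewrite andbT.
by move=> none; rewrite big_pred0.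
Qed.

Lemma residual_eval m : env m -> nmem m CJ 0 < n ->
  reval oracle m residual = res m (nmem m CJ 0) (nmem m CT 0).
Proof. by move=> [_ _ _ [_ _ off]] jn; rewrite /= off. Qed.

Lemma run_select k m : violated k m ->
  let m' := run select m in
  let j := nmem m' SEL 0 in let u := nmem m' SELD 0 in
  let aff := affected r (nmem m DUE) k (nmem m XT 0) in
  [/\ j < n, u <= h, aff j u,
      rmem m' ALPHA 0 = (res m j u / (weight p (nmem m XS 0) j)%:R)%R
    & forall i v, i < n -> v <= h -> aff i v ->
        (rmem m' ALPHA 0 <= res m i v / (weight p (nmem m XS 0) i)%:R)%R].
Proof.
move=> viol; rewrite /select run_seq; cbv zeta.
set m0 := run _ m; set body := (X in PFor CJ NJ (PFor CT HZ X)).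
have viol0 : violated k m0 by exact: (violated_agree (agree_run oracle _ m)).
have [res0 d0 xt0 xs0] : [/\ res m0 = res m, nmem m0 DUE = nmem m DUE,
  nmem m0 XT = nmem m XT & nmem m0 XS = nmem m XS] by [].
rewrite -res0 -d0 -xt0 -xs0.
set aff := affected r _ k _; set W := weight p _.
(* Either no affected entry has been met, or [SEL] and [SELD] hold one of least ratio among those
   met. *)
pose P j u m' :=
  nmem m' FOUND 0 = 0 /\ (forall i v, i < n -> v < h.+1 -> visited j u i v -> ~~ aff i v)
  \/ [/\ nmem m' FOUND 0 = 1, nmem m' SEL 0 < n /\ nmem m' SELD 0 < h.+1,
     aff (nmem m' SEL 0) (nmem m' SELD 0),
     rmem m' ALPHA 0 =
       (res m0 (nmem m' SEL 0) (nmem m' SELD 0) / (W (nmem m' SEL 0))%:R)%R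
   & forall i v, i < n -> v < h.+1 -> visited j u i v -> aff i v ->
       (rmem m' ALPHA 0 <= res m0 i v / (W i)%:R)%R].
have [[m0n _ _ [m0h _ _]] _ _ _ _] := viol0.
suff : P (nmem m0 NJ 0) 0 (run (PFor CJ NJ (PFor CT HZ body)) m0).
  move: (run (PFor _ _ _) m0) => m1 [[_ none]|[_ [jn uh] a alE alle]].
    have [j jn ja] : exists2 j, j < n & aff j h := violated_affected viol0.
    by have := none j h jn (leqnn _); rewrite /visited m0n jn ja => /(_ isT).
  by split=> // i v i_n vh; apply: alle => //; rewrite /visited m0n i_n.
apply: (run_for2 (P := P)) => //.
- by left; split=> // i v _ _; rewrite /visited !ltn0 andbF.
- rewrite m0h => j m' _ [[f0 none]|[f1 jn a alE alle]]; [left|right].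
    by split=> // i v i_n vh; rewrite visited_next //; apply: none.
  by split=> // i v i_n vh; rewrite visited_next //; apply: alle.
move=> j u m'; rewrite m0n m0h => jn uh ag mJ mT Pm'.
have viol' : violated k m' by exact: (violated_agree ag).
have [env' _ _ _ _] := viol'.
have affE : affected r (nmem m' DUE) k (nmem m' XT 0) (nmem m' CJ 0) (nmem m' CT 0)
   = aff j u by rewrite mJ mT !ag.1.
have keep m1 : ~~ aff j u ->
    P j u m1 -> P j u.+1 m1.
  move=> aF [[f0 none]|[f1 jn1 a alE alle]]; [left|right]; split=> // i v i_n vh.
    by rewrite visited_step => /orP[|/andP[/eqP -> /eqP ->] //]; apply: none.
  rewrite visited_step => /orP[|/andP[/eqP -> /eqP ->]]; first exact: alle.
  by rewrite (negbTE aF).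
rewrite /body run_when (run_affected_test viol') affE.
case: ifP => aff_ju; last by apply: keep => //; rewrite aff_ju.
rewrite 2!run_seq.
have wE := run_compute_weight viol'.
have ag1 := agree_run oracle compute_weight m'.
move: (run compute_weight m') wE ag1 => m1 wE ag1.
have {}wE : nmem m1 WT 0 = W j by rewrite wE mJ ag.1.
have env1 : env m1 by exact: (env_agree ag1).
have [mJ1 mT1] : nmem m1 CJ 0 = j /\ nmem m1 CT 0 = u by rewrite !ag1.1.
have resE : reval oracle m1 residual = res m0 j u.
  by rewrite (residual_eval env1) ?mJ1 // mT1 /res ag1.2 // ag.2.
set m2 := run (PR _ _ _) m1.
have ratio2 : rmem m2 RATIO 0 = (res m0 j u / (W j)%:R)%R.
  by rewrite -resE -wE.
have {}Pm' : P j u m2.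
  move: Pm'; rewrite /P.
  have -> : rmem m2 ALPHA = rmem m' ALPHA by rewrite -(ag1.2 ALPHA isT).
  have -> : nmem m2 FOUND = nmem m' FOUND by rewrite -(ag1.1 FOUND isT).
  have -> : nmem m2 SEL = nmem m' SEL by rewrite -(ag1.1 SEL isT).
  by have -> : nmem m2 SELD = nmem m' SELD by rewrite -(ag1.1 SELD isT).
have [mJ2 mT2] : nmem m2 CJ 0 = j /\ nmem m2 CT 0 = u by [].
move: m2 ratio2 Pm' mJ2 mT2 => m2 ratio2 Pm' mJ2 mT2.
rewrite run_when /= ratio2; case: ifPn; last first.
  rewrite negbK => /andP[f1 al]; right.
  case: Pm' => [[f0 _]|[f1' jn1 a alE alle]]; first by rewrite f0 in f1.
  split=> // i v i_n vh; rewrite visited_step => /orP[|/andP[/eqP -> /eqP ->] //].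
  exact: alle.
move=> cond; right; rewrite /update /= mJ2 mT2; split=> // i v i_n vh.
rewrite visited_step => /orP[dn|/andP[/eqP -> /eqP ->] //] a.
case: Pm' => [[_ none]|[f1 _ _ _ alle]].
  by have := none i v i_n vh dn; rewrite a.
apply: le_trans (alle i v i_n vh dn a); rewrite f1 /= in cond.
by rewrite ltW // ltNge.
Qed.

Lemma offset_inj i v j u : v < h.+1 -> u < h.+1 ->
  (i * h.+1 + v == j * h.+1 + u) = (i == j) && (v == u).
Proof.
move=> vh uh; apply/eqP/andP => [E|[/eqP -> /eqP -> //]].
have ij : i = j.
  by have := congr1 (divn^~ h.+1) E; rewrite !divnMDl // !divn_small // !addn0.
by move: E; rewrite ij => /addnI ->.
Qed.

Lemma run_reduce k m : violated k m ->
  forall i v, i < n -> v <= h -> res (run reduce_residual m) i v =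
    reduce n p r (nmem m DUE) k (nmem m XT 0) (rmem m ALPHA 0) (res m) i v.
Proof.
move=> viol; rewrite /reduce_residual.
set body := (X in PFor CJ NJ (PFor CT HZ X)).
set red := reduce _ _ _ _ _ _ _ _.
(* Each entry is rewritten only at its own turn, so the value read there is the original one. *)
pose P j u m' := forall i v, i < n -> v < h.+1 ->
  res m' i v = if visited j u i v then red i v else res m i v.
have [[mn _ _ [mh _ _]] _ _ _ xsE] := viol.
suff PP : P (nmem m NJ 0) 0 (run (PFor CJ NJ (PFor CT HZ body)) m).
  by move=> i v i_n vh; rewrite PP // /visited mn i_n.
apply: (run_for2 (P := P)) => //.
- by move=> i v _ _; rewrite /visited !ltn0 andbF.
- by rewrite mh => j m' _ Pm' i v i_n vh; rewrite visited_next //; apply: Pm'.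
move=> j u m'; rewrite mn mh => jn uh ag mJ mT Pm'.
have viol' : violated k m' by exact: (violated_agree ag).
rewrite /body run_when (run_affected_test viol') mJ mT !ag.1 //.
case: ifP => aff; last first.
  move=> i v i_n vh; rewrite Pm' // visited_step.
  case: (boolP (_ && _)) => [/andP[/eqP -> /eqP ->]|_]; last by rewrite orbF.
  by rewrite orbT /red /reduce aff if_same.
rewrite run_seq; have wE := run_compute_weight viol'.
have ag1 := agree_run oracle compute_weight m'.
move: (run compute_weight m') wE ag1 => m1 wE ag1.
have {}wE : nmem m1 WT 0 = weight p (excess n p r (nmem m DUE) k (nmem m XT 0)) j.
  by rewrite wE mJ ag.1 // -xsE.
have [_ _ _ [_ _ off]] : env m1 by have [env' _ _ _ _] := viol'; exact: (env_agree ag1).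
have [mJ1 mT1] : nmem m1 CJ 0 = j /\ nmem m1 CT 0 = u by rewrite !ag1.1.
have res1 : res m1 = res m' by rewrite /res ag1.2.
have al1 : rmem m1 ALPHA 0 = rmem m ALPHA 0 by rewrite ag1.2 // ag.2.
move=> i v i_n vh; rewrite /res /= /update /= mJ1 mT1 off // offset_inj //.
rewrite visited_step.
case: (boolP (_ && _)) => [/andP[/eqP -> /eqP ->]|_]; last first.
  by rewrite orbF -/(res m1 i v) res1 Pm'.
rewrite orbT /red /reduce aff -/(res m1 j u) res1 wE al1 Pm' //.
by rewrite /visited eqxx !ltnn.
Qed.

(** Reversed, since [pushes] has the latest entry first. *)
Definition logof m :=
  [seq (nmem m LOGJ i, nmem m LOGD i) | i <- rev (iota 0 (nmem m LOGC 0))].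

Lemma run_push_selected m :
  let m' := run push_selected m in let j := nmem m SEL 0 in
  [/\ nmem m' LOGC 0 = (nmem m LOGC 0).+1,
      logof m' = (j, nmem m DUE j) :: logof m
    & nmem m' DUE = set_at (nmem m DUE) j (nmem m SELD 0)].
Proof.
split=> //; first by rewrite /= addn1.
rewrite /logof /= /update /= iotaD rev_cat map_cat /= !eqxx; congr (_ :: _).
apply/eq_in_map => i; rewrite mem_rev mem_iota /= add0n => lt_i.
by rewrite ltn_eqF.
Qed.

Lemma run_push k m : residual_ok n h (nmem m DUE) (res m) -> violated k m ->
  (forall k' t, k' < n -> excess n p r (nmem m DUE) k' t <= nmem m XS 0) ->
  let m' := run (select ;; reduce_residual ;; push_selected) m in
  exists j, [/\ push n h p r (nmem m DUE) (res m) j (nmem m' DUE) (res m'),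
    nmem m' LOGC 0 = (nmem m LOGC 0).+1
    & logof m' = (j, nmem m DUE j) :: logof m].
Proof.
move=> ok viol max_xs; rewrite 2!run_seq; cbv zeta.
have [jn uh aff alE alle] := run_select viol.
have ag1 := agree_run oracle select m.
have viol1 : violated k (run select m) by exact: (violated_agree ag1).
have res1 : res (run select m) = res m by rewrite /res ag1.2.
move: (run select m) jn uh aff alE alle ag1 viol1 res1.
move=> m1 jn uh aff alE alle ag1 viol1 res1.
have redE := run_reduce viol1; have ag2 := agree_run oracle reduce_residual m1.
move: (run reduce_residual m1) redE ag2 => m2 redE ag2.
have [cE lE dE] := run_push_selected m2.
have ag3 := agree_run oracle push_selected m2.
move: (run push_selected m2) cE lE dE ag3 => m3 cE lE dE ag3.
have [env_m kn xr pos xsE] := viol.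
set j := nmem m1 SEL 0 in jn aff alE *; set u := nmem m1 SELD 0 in uh aff alE *.
have j2 : nmem m2 SEL 0 = j by rewrite ag2.1.
have u2 : nmem m2 SELD 0 = u by rewrite ag2.1.
have d2 : nmem m2 DUE = nmem m DUE by rewrite ag2.1 ?ag1.1.
exists j; split; last 2 first.
- by rewrite cE ag2.1 // ag1.1.
- by rewrite lE j2 d2; congr (_ :: _); rewrite /logof !ag2.1 // !ag1.1.
have [sh g_ge0] := ok.
have w_gt0 i : i < n -> (0 < (weight p (nmem m XS 0) i)%:R :> R)%R.
  by move=> i_n; rewrite ltr0n /weight leq_min p_gt0.
have d1 : nmem m1 DUE = nmem m DUE by rewrite ag1.1.
have xt1 : nmem m1 XT = nmem m XT by rewrite ag1.1.
have res3 i v : i < n -> v <= h -> res m3 i v =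
   reduce n p r (nmem m DUE) k (nmem m XT 0) (rmem m1 ALPHA 0) (res m) i v.
  by move=> i_n vh; rewrite /res ag3.2 // -/(res m2 i v) redE // d1 xt1 res1.
(* As [alpha] is the least ratio, affected entries stay nonnegative and the selected one becomes 0;
   weights are positive, so the divisions are sound. *)
apply: (@Push _ _ _ _ _ _ _ _ _ _ k (nmem m XT 0) u (rmem m1 ALPHA 0)) => //.
- by rewrite -xsE.
- by rewrite -xsE.
- by rewrite alE divr_ge0 // g_ge0.
- by rewrite dE j2 u2 d2.
- move=> i v i_n vh; rewrite res3 // /reduce -xsE; case: ifP => [a|_].
    by rewrite subr_ge0 -ler_pdivlMr ?w_gt0 // alle.
  exact: g_ge0.
- by rewrite res3 // /reduce aff -xsE alE divfK ?subrr // lt0r_neq0 // w_gt0.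
Qed.

(* Each push increases the sum of the due dates, so [n * h.+1] pushes are
   enough to cover. *)
Lemma run_forward m : env m -> residual_ok n h (nmem m DUE) (res m) ->
  nmem m LOGC 0 = 0 ->
  let m' := run forward m in
  [/\ pushes n h p r (nmem m DUE) (res m) (logof m') (nmem m' DUE) (res m'),
      covers n p r (nmem m' DUE) & nmem m' LOGC 0 <= n * h.+1].
Proof.
move=> env_m ok c0; rewrite /forward; set body := (X in PFor CI NH X).
pose P i m' := [/\ pushes n h p r (nmem m DUE) (res m) (logof m') (nmem m' DUE) (res m'),
  covers n p r (nmem m' DUE) \/ i <= \sum_(j < n) nmem m' DUE j
  & nmem m' LOGC 0 <= i].
have [_ _ _ [_ mN _]] := env_m.
suff [ps cov_or cN] : P (n * h.+1) (run (PFor CI NH body) m).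
  split=> //; have [sh _] := pushes_ok ok ps; case: cov_or => // le_sum k t kn.
  (* Due dates up to [h] sum to at most [n * h], which is below [n * h.+1] because [k < n]. *)
  have : \sum_(j < n) nmem (run (PFor CI NH body) m) DUE j <= \sum_(j < n) h.
    by apply: leq_sum => j _; have [] := sh j (ltn_ord j).
  by rewrite sum_nat_const card_ord; nia.
rewrite -{1}mN; apply: (run_for (P := P)) => //.
  split=> //; last by rewrite c0.
    by rewrite /logof c0; exact: Pushes0.
  by right.
move=> i m' _ ag mI [ps cov_or ci].
have env' : env m' by exact: (env_agree ag).
have ok' := pushes_ok ok ps.
rewrite /body run_seq run_when.
have [max_xs ex_xs] := run_find_max_excess env'.
have ag1 := agree_run oracle find_max_excess m'.
have env1 : env (run find_max_excess m') by exact: (env_agree ag1).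
move: (run find_max_excess m') max_xs ex_xs ag1 env1.
move=> m1 max_xs ex_xs ag1 env1.
have d1 : nmem m1 DUE = nmem m' DUE by rewrite ag1.1.
have res1 : res m1 = res m' by rewrite /res ag1.2.
have log1 : logof m1 = logof m' by rewrite /logof !ag1.1.
have c1 : nmem m1 LOGC 0 = nmem m' LOGC 0 by rewrite ag1.1.
rewrite -d1 -res1 -log1 in ps ok' *; rewrite -d1 in max_xs ex_xs cov_or.
rewrite -c1 in ci.
rewrite /P [beval _ _ _]/=; case: ifP => xs.
  have [k [kn xr xsE]] := ex_xs xs.
  have viol : violated k m1 by split.
  have [j [pu cE lE]] := run_push ok' viol max_xs.
  move: (run _ m1) pu cE lE => m2 pu cE lE; split.
  - by rewrite lE; apply: PushesS ps pu.
  - right; case: cov_or => [cov|le_sum]; last exact: leq_ltn_trans (push_grows pu).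
    by move: xs; rewrite xsE cov.
  - by rewrite cE.
split=> //; last exact: leqW.
left=> k t kn; apply/eqP; rewrite -leqn0.
by apply: leq_trans (max_xs k t kn) _; rewrite leqNgt xs.
Qed.

Lemma logof_pop m : 0 < nmem m LOGC 0 ->
  let c := nmem m LOGC 0 - 1 in
  logof m = (nmem m LOGJ c, nmem m LOGD c) :: logof (nset m LOGC 0 c).
Proof.
move=> c_gt0 c; rewrite /logof /update /=.
rewrite (_ : nmem m 11 0 = c + 1); last by rewrite /c subnK.
by rewrite iotaD rev_cat.
Qed.

(** Invariant: the rest of the log leads to some [s] and [g] for which the current due dates are
    near optimal. The program does not restore the earlier residual costs [g]; they live in the
    proof only. *)
Lemma run_backward m s0 (g0 g : nat -> nat -> R) : env m -> residual_ok n h s0 g0 ->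
  pushes n h p r s0 g0 (logof m) (nmem m DUE) g ->
  covers n p r (nmem m DUE) -> nmem m LOGC 0 <= n * h.+1 ->
  near_optimal n h p r s0 g0 (nmem (run backward m) DUE).
Proof.
move=> env_m ok0 ps cov cN; rewrite /backward; set body := (X in PFor CI NH X).
pose P i m' := nmem m' LOGC 0 = nmem m LOGC 0 - i /\
  exists s g, pushes n h p r s0 g0 (logof m') s g /\
    near_optimal n h p r s g (nmem m' DUE).
have [_ _ _ [_ mN _]] := env_m.
suff : P (n * h.+1) (run (PFor CI NH body) m).
  move: (run (PFor CI NH body) m) => m1 [c0 [s [g' [ps' opt]]]].
  move: ps'; rewrite /logof c0 (_ : _ - _ = 0) /=; last by apply/eqP; rewrite subn_eq0.
  by move=> /pushes_nil[<- <-].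
rewrite -{1}mN; apply: (run_for (P := P)) => //.
  split; first by rewrite subn0.
  by exists (nmem m DUE), g; split=> //; apply: near_optimal_ok (pushes_ok ok0 ps) cov.
move=> i m' _ ag mI [cE [s' [g' [ps' opt]]]].
have env' : env m' by exact: (env_agree ag).
rewrite /body run_when [beval _ _ _]/=; case: ifP => c_gt0; last first.
  by split; [lia|exists s', g'].
rewrite 5!run_seq run_when.
move: ps'; rewrite logof_pop //.
set c := nmem m' LOGC 0 - 1; set j := nmem m' LOGJ c.
move=> /pushes_cons[s [g1 [ps1 pu oldE]]].
set m1 := run (PN DUE _ _) _.
have [c1 j1 old1 d1] : [/\ nmem m1 LOGC 0 = c, nmem m1 SEL 0 = j,
   nmem m1 OLD 0 = nmem m' DUE j & nmem m1 DUE = set_at (nmem m' DUE) j (s j)].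
  by split=> //; rewrite -oldE.
have lj1 : nmem m1 LOGJ = nmem m' LOGJ by [].
have ld1 : nmem m1 LOGD = nmem m' LOGD by [].
have env1 : env m1 by [].
move: m1 c1 j1 old1 d1 lj1 ld1 env1 => m1 c1 j1 old1 d1 lj1 ld1 env1.
have [max_xs ex_xs] := run_find_max_excess env1.
have ag2 := agree_run oracle find_max_excess m1.
move: (run find_max_excess m1) max_xs ex_xs ag2 => m2 max_xs ex_xs ag2.
have d2 : nmem m2 DUE = set_at (nmem m' DUE) j (s j) by rewrite ag2.1.
have c2 : nmem m2 LOGC 0 = c by rewrite ag2.1.
have j2 : nmem m2 SEL 0 = j by rewrite ag2.1.
have old2 : nmem m2 OLD 0 = nmem m' DUE j by rewrite ag2.1.
have log2 : logof m2 = logof (nset m' LOGC 0 c).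
  by rewrite /logof !ag2.1 // c1 lj1 ld1.
have undo := near_optimal_undo (pushes_ok ok0 ps1) pu opt.
rewrite [beval _ _ _]/=; case: ifP => xs; split; rewrite ?c2; try lia.
- by rewrite /= /update /= c2 /c cE; lia.
- exists s, g1; split; first by rewrite -log2 in ps1.
  apply: undo; right; split.
    rewrite /= /update /= j2 old2 d2; apply: funext => i'.
    by rewrite /set_at; case: eqVneq => [->|].
  have [k [kn _ xsE]] := ex_xs xs.
  by move=> cov'; move: xs; rewrite xsE d1 cov'.
- exists s, g1; split; first by rewrite log2.
  apply: undo; left; rewrite d2; split=> // k t kn; apply/eqP.
  by rewrite -leqn0 -d1 (leq_trans (max_xs k t kn)) // leqNgt xs.
Qed.

Lemma run_init_residual m : env m -> (forall i, rmem m RES i = 0%R) ->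
  forall j t, j < n -> t <= h -> res (run init_residual m) j t =
    (if 0 < t then oracle j t else 0%R).
Proof.
move=> env_m res0; rewrite /init_residual; set body := (X in PFor CJ NJ (PFor CT HZ X)).
pose P j u m' := forall i v, i < n -> v < h.+1 ->
  res m' i v = if visited j u i v && (0 < v) then oracle i v else 0%R.
have [mn _ _ [mh _ off]] := env_m.
suff PP : P (nmem m NJ 0) 0 (run (PFor CJ NJ (PFor CT HZ body)) m).
  by move=> i v i_n vh; rewrite PP // /visited mn i_n.
apply: (run_for2 (P := P)) => //.
- by move=> i v _ _; rewrite /res res0 /visited !ltn0 andbF.
- by rewrite mh => j m' _ Pm' i v i_n vh; rewrite visited_next //; apply: Pm'.
move=> j u m'; rewrite mn mh => jn uh ag mJ mT Pm' i v i_n vh.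
have off' : nmem m' OFF j = j * h.+1 by rewrite ag.1 // off.
rewrite visited_step /body run_when [beval _ _ _]/= mT.
case: ifPn => u_gt0; last first.
  rewrite Pm' //; case: (boolP ((i == j) && (v == u))) => [/andP[/eqP -> /eqP ->]|_].
    by rewrite (negbTE u_gt0) !andbF.
  by rewrite orbF.
rewrite /res /= /update /= mJ mT off' offset_inj //.
case: (boolP ((i == j) && (v == u))) => [/andP[/eqP -> /eqP ->]|_].
  by rewrite orbT u_gt0.
by rewrite orbF -Pm'.
Qed.

Definition available m j :=
  [&& j < n, r j <= nmem m CT 0 & 0 < nmem m REM j].

Lemma run_select_edd m : env m ->
  let m' := run select_edd m in
  if 0 < nmem m' FOUND 0 then
    available m (nmem m' SEL 0) /\
    forall i, available m i -> nmem m DUE (nmem m' SEL 0) <= nmem m DUE i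
  else forall i, ~~ available m i.
Proof.
move=> env_m; rewrite /select_edd run_seq; cbv zeta; set m0 := run _ m.
set body := (X in PFor CJ NJ X).
have env0 : env m0 by [].
have [av0 d0] : available m0 = available m /\ nmem m0 DUE = nmem m DUE by [].
have f0 : nmem m0 FOUND 0 = 0 by [].
rewrite -av0 -d0; move: m0 env0 f0 {av0 d0} => m0 env0 f0.
pose P j m' := if 0 < nmem m' FOUND 0 then
    available m0 (nmem m' SEL 0) /\
    forall i, i < j -> available m0 i -> nmem m0 DUE (nmem m' SEL 0) <= nmem m0 DUE i
  else forall i, i < j -> ~~ available m0 i.
have [mn _ mr _] := env0.
suff : P (nmem m0 NJ 0) (run (PFor CJ NJ body) m0).
  have av_n i : available m0 i -> i < n by case/andP.
  rewrite mn /P; case: ifP => _.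
    by move=> [av le_d]; split=> // i av_i; apply: le_d => //; apply: av_n.
  move=> none i; apply/negP => av_i; move: (av_i); apply/negP; apply: none.
  exact: av_n.
apply: (run_for (P := P)) => //; first by rewrite /P f0.
move=> j m'; rewrite mn => jn ag mJ Pm'.
have rd : nmem m' RD = r by rewrite ag.1 // mr.
have avE : (r j <= nmem m' CT 0) && (0 < nmem m' REM j) = available m0 j.
  by rewrite /available jn !ag.1.
have d' : nmem m' DUE = nmem m0 DUE by rewrite ag.1.
rewrite /body run_when [beval _ _ _]/= mJ rd avE d'.
case: ifPn => [/andP[av cond]|cond].
  rewrite /P /= /update /= mJ; split=> // i; rewrite ltnS leq_eqVlt.
  move=> /orP[/eqP -> //|ij av_i]; move: Pm' cond; rewrite /P.
  case: ltnP => /= _; last by move=> none; have := none i ij; rewrite av_i.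
  by move=> [_ le_d]; rewrite -ltnNge => /ltnW /leq_trans; apply; apply: le_d.
move: Pm' cond; rewrite /P negb_and negbK.
case: ifPn => _ /=; last first.
  rewrite orbF => none nav i; rewrite ltnS leq_eqVlt => /orP[/eqP -> //|].
  exact: none.
move=> [av le_d] cond; split=> // i; rewrite ltnS leq_eqVlt => /orP[/eqP ->|].
  by move=> av_j; move: cond; rewrite av_j.
exact: le_d.
Qed.

Lemma run_edd m : env m -> covers n p r (nmem m DUE) -> nmem m OUTC 0 = 0 ->
  let m' := run edd m in
  exists rem l, [/\ edd_inv n p r (nmem m DUE) h.+1 rem l,
    nmem m' OUTC 0 = size l,
    l = [seq (nmem m' OUTJ i, nmem m' OUTS i) | i <- iota 0 (size l)]
    & forall i, i < size l -> nmem m' OUTE i = (nmem m' OUTS i).+1].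
Proof.
move=> env_m cov out0; rewrite /edd run_seq; cbv zeta.
have [m1 [-> env1 out1 d1 rem1]] : exists m1,
    [/\ run (PFor CK NJ (PN REM (var CK) (NGet PT (var CK)))) m = m1, env m1,
    nmem m1 OUTC 0 = 0, nmem m1 DUE = nmem m DUE
    & forall j, j < n -> nmem m1 REM j = p j].
  exists (run (PFor CK NJ (PN REM (var CK) (NGet PT (var CK)))) m).
  have ag := agree_run oracle (PFor CK NJ (PN REM (var CK) (NGet PT (var CK)))) m.
  split=> //; [exact: (env_agree ag)|by rewrite ag.1|by rewrite ag.1|].
  have [mn mp _ _] := env_m.
  pose P k m' := forall j, j < k -> nmem m' REM j = p j.
  rewrite -mn; apply: (run_for (P := P)) => // k m' kn ag' mK Pm' j.
  rewrite ltnS /= /update /= mK ag'.1 // mp.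
  by case: eqVneq => [->//|jk]; rewrite leq_eqVlt (negbTE jk); apply: Pm'.
rewrite -d1 in cov *; move: m1 env1 out1 rem1 cov {d1}.
move=> {env_m out0} {}m env_m out0 rem0 cov.
set body := (X in PFor CT HZ X).
pose P u m' := exists l, [/\ edd_inv n p r (nmem m DUE) u (nmem m' REM) l,
    nmem m' OUTC 0 = size l,
    l = [seq (nmem m' OUTJ i, nmem m' OUTS i) | i <- iota 0 (size l)]
    & forall i, i < size l -> nmem m' OUTE i = (nmem m' OUTS i).+1].
have [_ _ _ [mh _ _]] := env_m.
suff [l Pl] : P h.+1 (run (PFor CT HZ body) m).
  by exists (nmem (run (PFor CT HZ body) m) REM), l.
rewrite -{1}mh; apply: (run_for (P := P)) => //.
  by exists [::]; split=> //; apply: edd_inv0.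
move=> u m' _ ag mT [l [inv cE lE eE]].
have env' : env m' by exact: (env_agree ag).
have d' : nmem m' DUE = nmem m DUE by rewrite ag.1.
rewrite /body run_seq run_when.
have := run_select_edd env'; have ag1 := agree_run oracle select_edd m'.
rewrite /available mT d'; cbv zeta.
move: (run select_edd m') ag1 => m1 ag1.
have [rem1 c1 j1 s1] : [/\ nmem m1 REM = nmem m' REM, nmem m1 OUTC = nmem m' OUTC,
  nmem m1 OUTJ = nmem m' OUTJ & nmem m1 OUTS = nmem m' OUTS] by rewrite !ag1.1.
have e1 : nmem m1 OUTE = nmem m' OUTE by rewrite ag1.1.
have t1 : nmem m1 CT 0 = u by rewrite ag1.1.
rewrite [beval _ _ _]/=; case: ifP => _; last first.
  move=> none; exists l; rewrite c1 j1 s1 e1 rem1; split=> //.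
  apply: edd_inv_idle => // j jn rj; apply/eqP; rewrite -leqn0 leqNgt.
  by have := none j; rewrite jn rj.
set j := nmem m1 SEL 0 => -[/and3P[jn rj remj] le_d].
exists (rcons l (j, u)).
have lt_ne i : i < size l -> (i == size l) = false by move=> /ltn_eqF.
split.
- rewrite /= /update /= -/j rem1; apply: edd_inv_work => // i i_n ri remi.
  by apply: le_d; rewrite i_n ri.
- by rewrite /= /update /= c1 cE size_rcons addn1.
- rewrite size_rcons -[(size l).+1]addn1 iotaD map_cat cats1 /= /update /= c1 cE !eqxx.
  rewrite {1}lE t1 -/j; congr (rcons _ _).
  by apply/eq_in_map => i; rewrite mem_iota add0n /= => /lt_ne ->; rewrite j1 s1.
- move=> i; rewrite size_rcons ltnS leq_eqVlt /= /update /= c1 cE.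
  by case: eqVneq => [_ _|_ /= il]; rewrite ?t1 ?addn1 // e1 s1 eE.
Qed.

Lemma run_main m : env m -> (forall j, nmem m DUE j = 0) ->
  nmem m LOGC 0 = 0 -> nmem m OUTC 0 = 0 -> (forall i, rmem m RES i = 0%R) ->
  (forall j t, j < n -> (0 <= oracle j t)%R) ->
  let m' := run main_prog m in
  exists d l, [/\ forall x, x \in l -> [&& x.1 < n, r x.1 <= x.2 & x.2 < d x.1],
    uniq [seq x.2 | x <- l],
    forall j, j < n -> count (fun x => x.1 == j) l = p j,
    forall j, j < n -> 0 < d j
    & [/\ nmem m' OUTC 0 = size l,
      l = [seq (nmem m' OUTJ i, nmem m' OUTS i) | i <- iota 0 (size l)],
      forall i, i < size l -> nmem m' OUTE i = (nmem m' OUTS i).+1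
      & forall e, (forall j, j < n -> e j <= h) -> covers n p r e ->
        (\sum_(j < n) oracle j (d j) <=
           (4 * nreleases n r)%:R * \sum_(j < n) oracle j (e j))%R]].
Proof.
move=> env_m due0 log0 out0 res0 cost_ge0; rewrite /main_prog 3!run_seq; cbv zeta.
have resE := run_init_residual env_m res0.
have ag1 := agree_run oracle init_residual m.
have env1 : env (run init_residual m) by exact: (env_agree ag1).
move: (run init_residual m) resE ag1 env1 => m1 resE ag1 env1.
have {}due0 j : nmem m1 DUE j = 0 by rewrite ag1.1.
have {}log0 : nmem m1 LOGC 0 = 0 by rewrite ag1.1.
have {}out0 : nmem m1 OUTC 0 = 0 by rewrite ag1.1.
have ok : residual_ok n h (nmem m1 DUE) (res m1).
  split=> [j jn|j t jn th]; first by rewrite due0 resE.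
  by rewrite resE //; case: ifP => // _; apply: cost_ge0.
have [ps cov logN] := run_forward env1 ok log0.
have ag2 := agree_run oracle forward m1.
have env2 : env (run forward m1) by exact: (env_agree ag2).
have {}out0 : nmem (run forward m1) OUTC 0 = 0 by rewrite ag2.1.
move: (run forward m1) ps cov logN env2 out0 {ag2} => m2 ps cov logN env2 out0.
have [sd cov' _ opt] := run_backward env2 ok ps cov logN.
have ag3 := agree_run oracle backward m2.
have env3 : env (run backward m2) by exact: (env_agree ag3).
have {}out0 : nmem (run backward m2) OUTC 0 = 0 by rewrite ag3.1.
move: (run backward m2) sd cov' opt env3 out0 {ag3} => m3 sd cov' opt env3 out0.
have [rem [l [inv cE lE eE]]] := run_edd env3 cov' out0.
have dh j : j < n -> nmem m3 DUE j <= h by move=> /sd /andP[].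
have d_gt0 j : j < n -> 0 < nmem m3 DUE j.
  by move=> jn; apply: leq_ltn_trans (covers_gt_release p_gt0 cov' jn).
exists (nmem m3 DUE), l; split=> //.
- by have [_ _ _ _ l_ok] := inv => x /l_ok /and4P[-> -> ->].
- by have [] := inv.
- by apply: edd_inv_done inv => j /dh /leqW.
split=> // e eh cove.
(* The final due dates are positive, where the initial residual table agrees with the oracle. *)
have -> : (\sum_(j < n) oracle j (nmem m3 DUE j) =
    residual_cost n (res m1) (nmem m3 DUE))%R.
  by apply: eq_bigr => j _; rewrite resE ?dh ?d_gt0.
(* For [e] an inequality suffices: the table is 0 at date 0, where the oracle is nonnegative. *)
apply: le_trans (opt e eh cove) _; rewrite ler_wpM2l // ler_sum // => j _.
by rewrite resE ?eh //; case: ifP => // _; apply: cost_ge0.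
Qed.

End Correctness.

(** * Prelude and running time *)

Lemma run_prelude (R : realType) (oracle : nat -> nat -> R) (n : nat)
    (p r : nat -> nat) (m : memory R) :
  nmem m NJ 0 = n -> nmem m PT = p -> nmem m RD = r ->
  nmem m XR 0 = 0 -> nmem m ACC 0 = 0 -> nmem m NH 0 = 0 ->
  env n (\max_(j < n) r j + \sum_(j < n) p j) p r (run oracle prelude m).
Proof.
move=> mn mp mr xr0 acc0 nh0; rewrite /prelude 2!run_seq.
set loop2 := PFor CK NJ _; set loop1 := PFor CK NJ _.
set h := _ + _.
have ag1 := agree_run oracle loop1 m.
pose P1 k (m' : memory R) := nmem m' XR 0 = \max_(j < k) r j /\
  nmem m' ACC 0 = \sum_(j < k) p j.
have : P1 n (run oracle loop1 m).
  rewrite -mn; apply: (run_for (P := P1)) => //; first by rewrite /P1 !big_ord0.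
  move=> k m' _ ag mK [xr acc].
  rewrite /P1 run_seq run_when [beval _ _ _]/= !big_ord_recr /= -xr -acc.
  have [rd pt] : nmem m' RD = r /\ nmem m' PT = p by rewrite !ag.1.
  by rewrite mK rd; case: leqP => /= _; rewrite /update /= mK ?rd pt.
move: (run oracle loop1 m) ag1 => m1 ag1 [xr acc].
set m2 := run oracle _ m1.
have [n2 p2 r2 nh2] : [/\ nmem m2 NJ 0 = n, nmem m2 PT = p, nmem m2 RD = r
    & nmem m2 NH 0 = 0].
  split; first by rewrite -mn -(ag1.1 NJ isT).
  - by rewrite -mp -(ag1.1 PT isT).
  - by rewrite -mr -(ag1.1 RD isT).
  - by rewrite -[LHS]/(nmem m1 NH 0) (ag1.1 NH isT).
have hz2 : nmem m2 HZ 0 = h.+1 by rewrite /= /update /= xr acc addn1.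
move: m2 n2 p2 r2 nh2 hz2 => m2 n2 p2 r2 nh2 hz2.
have ag2 := agree_run oracle loop2 m2.
pose P2 k (m' : memory R) := nmem m' NH 0 = k * h.+1 /\
  forall j, j < k -> nmem m' OFF j = j * h.+1.
have [nhE offE] : P2 n (run oracle loop2 m2).
  rewrite -n2; apply: (run_for (P := P2)) => //.
  move=> k m' _ ag mK [nhE offE]; rewrite /P2 /= /update /= mK nhE (ag.1 HZ isT) hz2.
  split=> [|j]; first by rewrite mulSnr.
  by rewrite ltnS leq_eqVlt; case: eqVneq => [->//|_ /= /offE].
split; rewrite ?(ag2.1 NJ isT) ?(ag2.1 PT isT) ?(ag2.1 RD isT) //.
by split; rewrite ?(ag2.1 HZ isT).
Qed.

Definition algorithm : cmd := compile (PSeq prelude main_prog).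

(** The loop bounds are [n], [h.+1] and [n * h.+1], all at most [(n + h).+1 ^ 2]. The two programs
    are timed separately, the second from the memory left by the first. *)
Lemma exec_algorithm (R : realType) (oracle : nat -> nat -> R) (n h : nat)
    (p r : nat -> nat) (m : memory R) :
  nmem m NJ 0 = n -> env n h p r (run oracle prelude m) ->
  exists2 t, exec oracle algorithm m t (run oracle (PSeq prelude main_prog) m)
    & t <= time ((n + h).+1 ^ 2) prelude + time ((n + h).+1 ^ 2) main_prog.
Proof.
move=> mn [n1 _ _ [h1 nh1 _]].
have [|b|t1 e1 le1] := @exec_run R oracle ((n + h).+1 ^ 2) prelude m.
- by [].
- by rewrite !inE => /orP[] /eqP ->; rewrite mn; lia.
have [|b|t2 e2 le2] := @exec_run R oracle ((n + h).+1 ^ 2) main_prog (run oracle prelude m).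
- by [].
- rewrite !inE.
  by do ![case/orP]; move=> /eqP ->; rewrite ?n1 ?h1 ?nh1; lia.
by exists (t1 + t2); [apply: exec_seq e1 e2|apply: leq_add].
Qed.

Lemma time_algorithm : exists a d, forall N,
  time (N.+1 ^ 2) prelude + time (N.+1 ^ 2) main_prog <= a * N.+1 ^ d.
Proof.
have [a [d H]] := time_polynomial (PSeq prelude main_prog).
(* The constants come from [(N.+1 ^ 2).+1 <= 2 * N.+1 ^ 2]. *)
exists (a * 2 ^ d), (2 * d) => N; apply: leq_trans (H (N.+1 ^ 2)) _.
rewrite -mulnA leq_mul2l expnM -expnMn; apply/orP; right.
by case: d {H} => [//|d]; rewrite leq_exp2r //; nia.
Qed.

End Program.

Local Open Scope ring_scope.

(** * Guarantees on an instance *)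

Section Instance.
Variables (R : realType) (I : instance R).
Local Notation n := (njobs I).
Local Notation p := (input_nmem I 1).
Local Notation r := (input_nmem I 2).
Local Notation h := (horizon I).

Lemma env_input : env n h p r (run (cost_oracle I) prelude (input I)).
Proof.
have -> : h = (\max_(j < n) r j + \sum_(j < n) p j)%N.
  by congr (_ + _)%N; apply: eq_bigr => j _; rewrite (input_rdate, input_ptime).
exact: run_prelude.
Qed.

Lemma input_ptime_gt0 j : (j < n)%N -> (0 < p j)%N.
Proof. by move=> jn; rewrite (input_ptime (Ordinal jn)) ptime_gt0. Qed.

Lemma input_horizon k : (k < n)%N -> (r k + \sum_(j < n) p j <= h)%N.
Proof.
move=> kn; rewrite (input_rdate (Ordinal kn)) /horizon.
rewrite (eq_bigr (ptime I)) => [|j _]; last exact: input_ptime.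
by rewrite leq_add2r (leq_bigmax (Ordinal kn)).
Qed.

Lemma cost_oracle_ge0 j t : (j < n)%N -> 0 <= cost_oracle I j t.
Proof. by move=> jn; rewrite (cost_oracleE (Ordinal jn)) jcost_ge0. Qed.

Lemma algorithm_halts : exists2 t,
    halts_on algorithm I t (run (cost_oracle I) (PSeq prelude main_prog) (input I))
  & (t <= time ((n + h).+1 ^ 2) prelude + time ((n + h).+1 ^ 2) main_prog)%N.
Proof. by apply: exec_algorithm env_input. Qed.

(** Monotonicity of the costs is used twice: the computed schedule completes jobs by their due
    dates, and the due dates read off [S'] are at most its completion times. *)
Lemma algorithm_schedule :
  exists S : schedule I,
    [/\ output (run (cost_oracle I) (PSeq prelude main_prog) (input I)) S,
      feasible S
    & forall S' : schedule I, feasible S' ->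
        total_cost S <= (4 * nrelease I)%:R * total_cost S'].
Proof.
have ag := agree_run (cost_oracle I) prelude (input I).
have [] := run_main (oracle := cost_oracle I) input_horizon input_ptime_gt0 env_input.
- by move=> j; rewrite ag.1.
- by rewrite ag.1.
- by rewrite ag.1.
- by move=> i; rewrite ag.2.
- by move=> j t jn; apply: cost_oracle_ge0.
rewrite -[run _ main_prog _]/(run (cost_oracle I) (PSeq prelude main_prog) (input I)).
move: (run _ _ _) => m d [l [l_ok uniq_l cnt_l d_gt0 [cE lE eE opt]]].
have [S [SE feas_S comp_S]] := unit_schedule l_ok uniq_l cnt_l.
exists S; split=> //.
  rewrite /output SE {1}lE cE -map_comp; apply/eq_in_map => i.
  by rewrite mem_iota add0n /= => il; rewrite eE.
move=> S' feas_S'.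
have := opt _ (fun j _ => integral_dues_le S' h j)
  (integral_dues_covers feas_S' input_horizon).
rewrite nreleases_input => /(le_trans _) bound.
apply: le_trans (bound _ _) _.
  apply: ler_sum => j _; rewrite cost_oracleE jcost_nondecreasing //.
  exact: completion_ge0.
rewrite ler_wpM2l // ler_sum // => j _.
by rewrite cost_oracleE jcost_nondecreasing // integral_dues_completion.
Qed.

End Instance.

Theorem theorem16 (R : realType) :
  exists A : cmd,
    pseudo_polynomial_time R A /\
    approximation_algorithm A (fun I : instance R => (4 * nrelease I)%:R).
Proof.
exists algorithm; split.
  have [a [d time_le]] := time_algorithm; exists a, d => I.
  have [t halts le_t] := algorithm_halts I.
  by exists t, (run (cost_oracle I) (PSeq prelude main_prog) (input I)); split=> //;
    apply: leq_trans le_t (time_le _).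
move=> I; have [t halts _] := algorithm_halts I.
have [S [out_S feas_S le_S]] := algorithm_schedule I.
exists t, (run (cost_oracle I) (PSeq prelude main_prog) (input I)), S; split=> //.
(* With factor 0, comparing [S] with itself already gives cost at most 0. *)
have [k0|k_gt0] := posnP (nrelease I).
  by have := le_S S feas_S; rewrite k0 muln0 !mul0r.
rewrite mulrC -ler_pdivrMr ?ltr0n ?muln_gt0 //.
(* Divided by the positive factor, the cost of [S] is a lower bound of all feasible costs, a set
   that contains the cost of [S]. *)
apply: lb_le_inf; first by exists (total_cost S), S.
move=> _ [S' feas_S' <-].
by rewrite ler_pdivrMr ?ltr0n ?muln_gt0 // mulrC le_S.
Qed.
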